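(* For every $n\ge k\ge 0$ with $n-k$ even, \[\sum_{m\in\mathcal{M}_{n,k}}q^{\mathrm{crn}(m)}t^{\mathrm{nest}(m)}\mathbf{x}^{\mathrm{MDes}(m)}=\sum_{m\in\mathcal{M}_{n,k}}q^{\mathrm{nest}(m)}t^{\mathrm{crn}(m)}\mathbf{x}^{\mathrm{Des}(m)}.\]
   Context: $\mathcal{M}_{n,k}$: partial matchings on $[n]$ with exactly $k$ unmatched points, identified with involutions in $S_n$ (pairs = 2-cycles); $\mathrm{Des}(m)=\{i\in[n-1]:\pi_i>\pi_{i+1}\}$ for the one-line notation of the involution. $\mathrm{MDes}(m)$: set of $i\in[n-1]$ such that (1) $\{i,i+1\}$ is a matched pair; or (2) $i,i+1$ lie on distinct pairs $\{i,a\},\{i+1,b\}$ that cross (arcs $\{x_1<y_1\},\{x_2<y_2\}$ cross if $x_1<x_2<y_1<y_2$ or $x_2<x_1<y_2<y_1$); or (3) $i$ is unmatched and $i+1$ matched. $\mathrm{crn}(m)$ (resp. $\mathrm{nest}(m)$): maximal $r$ with pairs $\{i_1,j_1\},\dots,\{i_r,j_r\}$, $i_1<\dots<i_r<j_1<\dots<j_r$ (resp. $i_1<\dots<i_r<j_r<\dots<j_1$). $\mathbf{x}^J=\prod_{j\in J}x_j$. *)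

(* Defs.v *)
From mathcomp Require Import all_boot all_fingroup all_algebra.
From mathcomp Require Export mpoly.

Set Implicit Arguments.
Unset Strict Implicit.
Unset Printing Implicit Defensive.

Import GRing.Theory.

(* The point p of [n] = {1, ..., n} is represented by the ordinal p - 1.  A
   partial matching is an involution of 'I_n; its unmatched points are the
   fixed points. *)
Definition matchings (n k : nat) : {set 'S_n} :=
  [set m : 'S_n | [forall p, m (m p) == p] & #|[set p | m p == p]| == k].

Section Statistics.

Variable n : nat.
Implicit Types (m : 'S_n) (p a b : 'I_n) (i : 'I_n.-1) (r : nat).

(* An element i of [n-1] is represented by 'I_n.-1, with the same shift; the
   two adjacent points i and i+1 of [n] are then lo i and hi i. *)
Definition lo i : 'I_n := widen_ord (leq_pred n) i.

Lemma hi_subproof i : i.+1 < n.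
Proof. by rewrite -ltn_predRL. Qed.

Definition hi i : 'I_n := Ordinal (hi_subproof i).

Definition Des m : {set 'I_n.-1} := [set i | m (hi i) < m (lo i)].

Definition matched m p : bool := m p != p.

(* The arcs {a, m a} and {b, m b}, with endpoints x1 < y1 and x2 < y2. *)
Definition arcs_cross m a b : bool :=
  let x1 := minn a (m a) in let y1 := maxn a (m a) in
  let x2 := minn b (m b) in let y2 := maxn b (m b) in
  [&& x1 < x2, x2 < y1 & y1 < y2] || [&& x2 < x1, x1 < y2 & y2 < y1].

Definition MDes m : {set 'I_n.-1} :=
  [set i | [|| m (lo i) == hi i,
               [&& matched m (lo i), matched m (hi i), m (lo i) != hi i
                 & arcs_cross m (lo i) (hi i)]
             | ~~ matched m (lo i) && matched m (hi i)]].

Definition increasing (s : seq 'I_n) : bool :=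
  sorted (fun a b => a < b) s.

(* s lists i_1, ..., i_r, and the j_l are the partners m i_l. *)
Definition has_crossing m r : bool :=
  [exists s : r.-tuple 'I_n, increasing (s ++ map m s)].

Definition has_nesting m r : bool :=
  [exists s : r.-tuple 'I_n, increasing (s ++ rev (map m s))].

(* Such a chain has 2r distinct points, so r <= n is no restriction. *)
Definition crn m : nat := \max_(r < n.+1 | has_crossing m r) r.

Definition nest m : nat := \max_(r < n.+1 | has_nesting m r) r.

Local Open Scope ring_scope.

Definition q_var : {mpoly int[2 + n.-1]} := 'X_(lshift n.-1 (0 : 'I_2)).

Definition t_var : {mpoly int[2 + n.-1]} := 'X_(lshift n.-1 (1 : 'I_2)).

Definition x_var i : {mpoly int[2 + n.-1]} := 'X_(rshift 2 i).

Definition x_mon (J : {set 'I_n.-1}) : {mpoly int[2 + n.-1]} :=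
  \prod_(j in J) x_var j.

End Statistics.

(* Main.v *)
Require Import Defs.
From mathcomp Require Import all_boot all_fingroup all_algebra.
From mathcomp Require Import zify.

Set Implicit Arguments.
Unset Strict Implicit.
Unset Printing Implicit Defensive.

(** Call a point a closer, an opener or a fixed point.  Both descent sets consist of the
    descents of the sequence of types, with closer < opener < fixed for MDes and
    closer < fixed < opener for Des, together with the crossing (for MDes) or nesting
    (for Des) pairs of adjacent openers or of adjacent closers.

    A matching is encoded by an oscillating tableau, read along the diagonal of a Fomin
    growth diagram; the maximal nesting is the largest first row and the maximal crossing
    the largest number of rows.  Whether two adjacent openers (or closers) cross is read
    off from the rows of the boxes that they add (remove), so transposing the tableau
    exchanges crossings and nestings, both globally and between adjacent points, and
    preserves the type of every point.

    It remains to replace the order closer < fixed < opener by closer < opener < fixed.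
    By Moebius inversion one may fix a set K and count the matchings whose descent set
    lies in K.  In those the types increase between consecutive cuts of K, and sorting
    each block according to the other order moves fixed points only, leaving the relative
    order of the matched points unchanged. *)

(** * Growth diagrams above the diagonal *)

(* The local rule of the growth diagram in terms of the rows (0 for none) of the boxes
   added across the top edge a and the left edge b; returns those of the bottom and right
   edges.  The argument x tells whether the cell is marked. *)
Definition cell (x : bool) (a b : nat) : nat * nat :=
  if a != b then (a, b) else if a == 0 then (x : nat, x : nat) else (a.+1, a.+1).

(* The cell (i, j) lies in column i and row j, and only the cells above the diagonal
   matter; e i j labels the edge of column i below row j, and f i j the edge of row j
   to the left of column i. *)
Definition growth n (X : nat -> nat -> bool) (e f : nat -> nat -> nat) : Prop :=
  [/\ forall i, i < n -> e i n = 0,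
      forall j, j < n -> f 0 j = 0,
      forall i j, i < j < n -> (e i j, f i.+1 j) = cell (X i j) (e i j.+1) (f i j)
    & forall i j, i < j < n -> X i j -> e i j.+1 = 0 /\ f i j = 0].

(** The partition at the corner left of column [i] and below row [j]; its boxes come from the marks
    in columns before [i] and rows from [j] on. *)
Definition shape (e : nat -> nat -> nat) i j k : nat := \sum_(i' < i) (e i' j == k).

(** Read on arcs, such a chain is a crossing when [i <= b]. In [se_chain] the columns decrease as
    the rows increase, which gives a nesting. *)
Fixpoint ne_chain n (X : nat -> nat -> bool) r i a b : Prop :=
  if r is r'.+1 then
    exists x y, [/\ a <= x < i, b <= y < n, X x y & ne_chain n X r' i x.+1 y.+1]
  else True.

Fixpoint se_chain n (X : nat -> nat -> bool) r i j : Prop :=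
  if r is r'.+1 then
    exists x y, [/\ x < i, j <= y < n, X x y & se_chain n X r' x y.+1]
  else True.

Lemma cellP x a b a' b' : (a', b') = cell x a b -> (x -> a = 0 /\ b = 0) ->
  [\/ [/\ x, a = 0, b = 0, a' = 1 & b' = 1],
      [/\ ~~ x, 0 < a, b = a, a' = a.+1 & b' = a.+1],
      [/\ ~~ x, a <> b, a' = a & b' = b] |
      [/\ ~~ x, a = 0, b = 0, a' = 0 & b' = 0]].
Proof.
rewrite /cell; case: (eqVneq a b) => [<-|nab] /=; last first.
  case=> -> -> hx; constructor 3; split=> //; last by apply/eqP.
  by apply/negP => /hx [a0 b0]; rewrite a0 b0 eqxx in nab.
case: (posnP a) => [->|a0] /=.
  by case: x => -[-> ->] hx; [constructor 1 | constructor 4].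

case=> -> -> hx; constructor 2; split=> //.
by apply/negP => /hx [a00]; rewrite a00 in a0.
Qed.

Section Growth.

Variables (n : nat) (X : nat -> nat -> bool) (e f : nat -> nat -> nat).
Hypothesis G : growth n X e f.

Let en0 i : i < n -> e i n = 0. Proof. by case: G => h _ _ _; apply: h. Qed.
Let f0j j : j < n -> f 0 j = 0. Proof. by case: G => _ h _ _; apply: h. Qed.

Lemma growth_cell i j : i < j < n ->
  [\/ [/\ X i j, e i j.+1 = 0, f i j = 0, e i j = 1 & f i.+1 j = 1],
      [/\ ~~ X i j, 0 < e i j.+1, f i j = e i j.+1, e i j = (e i j.+1).+1
        & f i.+1 j = (e i j.+1).+1],
      [/\ ~~ X i j, e i j.+1 <> f i j, e i j = e i j.+1 & f i.+1 j = f i j] |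
      [/\ ~~ X i j, e i j.+1 = 0, f i j = 0, e i j = 0 & f i.+1 j = 0]].
Proof. by case: G => _ _ c d hij; apply: cellP (c _ _ hij) (d _ _ hij). Qed.

Lemma shape0 j k : shape e 0 j k = 0.
Proof. by rewrite /shape big_ord0. Qed.

Lemma shapeSl i j k : shape e i.+1 j k = shape e i j k + (e i j == k).
Proof. by rewrite /shape big_ord_recr. Qed.

Lemma shapen i k : i <= n -> 0 < k -> shape e i n k = 0.
Proof.
move=> hi hk; rewrite /shape big1 // => i' _; rewrite en0 ?(leq_trans _ hi) //.
by case: k hk.
Qed.

(** By the local rule the two ways around a cell add the same rows, so the partition at a corner can
    also be computed along a column. *)
Lemma shape_row i j k : i <= j < n -> 0 < k ->
  shape e i j k = shape e i j.+1 k + (f i j == k).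
Proof.
move=> + hk; elim: i => [|i IH] hij.
  by rewrite !shape0 f0j ?(andP hij).2 //; case: k hk.
rewrite !shapeSl {}IH; last by lia.
by case: (@growth_cell i j) => [|[_ -> -> -> ->]|[_ _ -> -> ->]|[_ _ -> ->]|[_ -> -> -> ->]]; lia.
Qed.

(** Boxes that can be added separately in different rows can be added together, and a box added in
    row [r] leaves room for one in row [r + 1]. *)
Lemma shape_partition i j k : i <= j <= n -> 0 < k ->
  shape e i j k.+1 <= shape e i j k.
Proof.
move=> + hk; elim: i j => [|i IHi] j hij; first by rewrite !shape0.
have [d] : exists d, j + d = n by exists (n - j); lia.
elim: d j hij => [|d IHd] j hij hd.
  by rewrite -(_ : n = j) ?shapen //; lia.
have h1 := IHi j ltac:(lia); have h2 := IHd j.+1 ltac:(lia) ltac:(lia).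
have h3 := IHi j.+1 ltac:(lia).
move: h1 h2; rewrite !shapeSl.
rewrite !(@shape_row i j) //; try lia.
by case: (@growth_cell i j) => [|[_ -> -> -> _]|[_ ? -> -> _]|[_ ? -> _]|[_ -> -> -> _]]; lia.
Qed.

(** A column label changes only to one more than an equal row label, so the bounds for rows and for
    columns alternate from left to right. *)
Lemma row_labels_col_labels i j : (forall j', i <= j' < n -> f i j' <= i) ->
  i < j <= n -> e i j <= i.+1.
Proof.
move=> hf; have [d] : exists d, d = n - j by exists (n - j).
elim: d j => [|d IHd] j hd hij; first by rewrite -(_ : n = j) ?en0 //; lia.
have := IHd j.+1 ltac:(lia) ltac:(lia); have := hf j ltac:(lia).
by case: (@growth_cell i j) => [|[]|[]|[]|[]]; lia.
Qed.

Lemma row_label_le i j : i <= j < n -> f i j <= i.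
Proof.
elim: i j => [|i IH] j hij; first by rewrite f0j //; lia.
have := @row_labels_col_labels i j.+1 (fun j' h => IH j' h) ltac:(lia).
have := IH j ltac:(lia).
by case: (@growth_cell i j) => [|[]|[]|[]|[]]; lia.
Qed.

Lemma col_label_le i j : i < j <= n -> e i j <= i.+1.
Proof. by apply: row_labels_col_labels => j' /row_label_le. Qed.

Lemma shape_large i j k : i <= j <= n -> n < k -> shape e i j k = 0.
Proof.
move=> hij hk; rewrite /shape big1 // => i' _.
by have := @col_label_le i' j ltac:(have := ltn_ord i'; lia); have := ltn_ord i'; lia.
Qed.

Lemma shape_mono i j i' j' k : 0 < k -> i <= i' -> i' <= j' -> j' <= j <= n ->
  shape e i j k <= shape e i' j' k.
Proof.
move=> hk hii hij hjj; apply: (@leq_trans (shape e i' j k)).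
  rewrite -(subnKC hii) in hij *; elim: (i' - i) hij => [|d IH] hij; first by rewrite addn0.
  by rewrite addnS shapeSl; apply: leq_trans (leq_addr _ _); apply: IH; lia.
have [d hd] : exists d, j = j' + d by exists (j - j'); lia.
elim: d j' {hjj} hij hd (andP hjj).2 => [|d IH] j' hij hd hj.
  by rewrite hd addn0.
rewrite (@shape_row i' j') //; last by lia.
by apply: leq_trans (leq_addr _ _); apply: IH; lia.
Qed.

Lemma se_chain_mono r i j i' j' : i <= i' -> j' <= j ->
  se_chain n X r i j -> se_chain n X r i' j'.
Proof.
case: r => //= r hi hj [x [y [hx hy hX hr]]].
by exists x, y; split=> //; lia.
Qed.

(* The first row satisfies the recursion of the longest chain. *)
Lemma first_rowP r i j : i <= j <= n ->
  r <= shape e i j 1 <-> se_chain n X r i j.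
Proof.
move=> hij; split; last first.
  elim: r i j hij => //= r IH i j hij [x [y [hx hy hX /IH h]]].
  have {h} := h ltac:(lia).
  have := @shape_mono x.+1 y i j 1 isT ltac:(lia) ltac:(lia) ltac:(lia).
  rewrite shapeSl (@shape_row x y) //; last by lia.
  by case: (@growth_cell x y) => [|[_ _ ? ? _]|[]|[]|[]]; rewrite ?hX //; lia.
elim: i j r hij => [|i IHi] j r hij; first by rewrite shape0; case: r.
have [d] : exists d, d = n - j by exists (n - j).
elim: d j r hij => [|d IHd] j [|r] hij hd //.
  by rewrite -(_ : n = j) ?shapen //; lia.
have h1 := IHi j r.+1 ltac:(lia); have h2 := IHd j.+1 r.+1 ltac:(lia) ltac:(lia).
have h3 := IHi j.+1 r ltac:(lia).
have k1 := @se_chain_mono r.+1 i j i.+1 j (leqnSn i) (leqnn j).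
have k2 := @se_chain_mono r.+1 i.+1 j.+1 i.+1 j (leqnn _) (leqnSn j).
move=> hs.
(* A marked cell starts the chain; otherwise the length of the first row is already attained at one
   of two neighbouring corners. *)
case: (boolP (X i j)) => hX.
  exists i, j; split=> //; first by lia.
  apply: h3; move: hs; rewrite shapeSl (@shape_row i j) //; last by lia.
  by case: (@growth_cell i j) => [|[_ _ ? ? _]|[]|[]|[]]; rewrite ?hX //; lia.
suff: r < shape e i j 1 \/ r < shape e i.+1 j.+1 1.
  by case=> [/h1/k1|/h2/k2].
move: hs; rewrite !shapeSl (@shape_row i j) //; last by lia.
by case: (@growth_cell i j) => [|[h]|[]|[]|[]]; rewrite ?h // in hX *; lia.
Qed.

Lemma col_label_lt_pos i j y : i < j -> j <= y < n -> X i y -> 0 < e i j.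
Proof.
move=> hij hy hX; have [d] : exists d, y = j + d by exists (y - j); lia.
elim: d j hij hy => [|d IH] j hij hy hd.
  rewrite hd addn0 in hX.
  by case: (@growth_cell i j) => [|[_ _ _ -> _]|[]|[]|[]]; rewrite ?hX //; lia.
have := IH j.+1 ltac:(lia) ltac:(lia) ltac:(lia).
by case: (@growth_cell i j) => [|[]|[]|[]|[]]; lia.
Qed.

Lemma row_label_pos x i j : x < i <= j -> j < n -> X x j -> 0 < f i j.
Proof.
move=> hij hy hX; have [d] : exists d, i = x.+1 + d by exists (i - x.+1); lia.
elim: d i hij => [|d IH] i hij hd.
  rewrite (_ : i = x.+1); last by lia.
  by case: (@growth_cell x j) => [|[_ _ _ _ ->]|[]|[]|[]]; rewrite ?hX //; lia.
have := IH i.-1 ltac:(lia) ltac:(lia).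
by case: (@growth_cell i.-1 j) => [|[]|[]|[]|[]]; rewrite ?prednK; lia.
Qed.

(** Going down a column, the label never decreases and becomes positive only at a mark. *)
Lemma col_labelP i j : i < j <= n -> 0 < e i j <-> exists2 y, j <= y < n & X i y.
Proof.
move=> hij; split=> [|[y hy hX]]; last by apply: (@col_label_lt_pos i j y) => //; lia.
have [d] : exists d, d = n - j by exists (n - j).
elim: d j hij => [|d IHd] j hij hd; first by rewrite -(_ : n = j) ?en0 //; lia.
have h := IHd j.+1 ltac:(lia) ltac:(lia).
case: (@growth_cell i j) => [|[hX _ _ _ _ _]|[_ h1 _ _ _ _]|[_ _ -> _ h1]|[_ _ _ -> _]] //; try lia.
- by exists j => //; lia.
- by have [y hy hX] := h h1; exists y => //; lia.
- by have [y hy hX] := h h1; exists y => //; lia.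
Qed.

Lemma row_labelP i j : i <= j < n -> 0 < f i j <-> exists2 x, x < i & X x j.
Proof.
move=> hij; split=> [|[x hx hX]]; last by apply: (@row_label_pos x i j) => //; lia.
elim: i hij => [|i IHi] hij; first by rewrite f0j //; lia.
have h := IHi ltac:(lia).
case: (@growth_cell i j) => [|[hX _ _ _ _ _]|[_ h1 h2 _ _ _]|[_ _ _ -> h1]|[_ _ _ _ ->]] //; try lia.
- by exists i.
- by have [x hy hX] := h ltac:(lia); exists x => //; lia.
- by have [x hy hX] := h h1; exists x => //; lia.
Qed.

End Growth.

Lemma ne_chain_mono n X r i a b i' a' b' : i <= i' -> a' <= a -> b' <= b ->
  ne_chain n X r i a b -> ne_chain n X r i' a' b'.
Proof.
move=> hi; elim: r a b a' b' => //= r IH a b a' b' ha hb [x [y [hx hy hX hr]]].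
by exists x, y; split=> //; try lia; apply: IH hr.
Qed.

(** * Shadow lines and the number of rows *)

Section Peel.

Variables (n : nat) (X : nat -> nat -> bool) (e f : nat -> nat -> nat).
Hypothesis G : growth n X e f.

(* Viennot's shadow lines: the corners where two labels 1 meet. *)
Definition peel (i j : nat) : bool := (e i j.+1 == 1) && (f i j == 1).

(** Deleting all first rows lowers every positive label by one. A cell turning two labels 1 into 2
    then turns 0 into 1, so it acts as a marked cell. *)
Lemma peel_growth : growth n peel (fun i j => (e i j).-1) (fun i j => (f i j).-1).
Proof.
split=> [i hi|j hj|i j hij|i j hij /andP[/eqP -> /eqP ->]] //.
- by case: G => -> .
- by case: G => _ -> .
rewrite /peel.
case: (growth_cell G hij) => -[_].
- by move=> -> -> -> ->.
- by rewrite /cell; case: (e i j.+1) => [|[|a]] // _ -> -> ->; rewrite eqxx.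
- rewrite /cell; case: (e i j.+1) (f i j) => [|[|a]] [|[|b]] //= hab -> -> //.
  by case: (eqVneq a b) hab => [-> //|hab _]; rewrite eqSS (negPf hab).
- by move=> -> -> -> ->.
Qed.

Lemma shape_peel i j k :
  0 < k -> shape (fun i j => (e i j).-1) i j k = shape e i j k.+1.
Proof.
by case: k => // k _; apply: eq_bigr => i' _; case: (e i' j).
Qed.

(** A label 1 arises only at a mark, so it can be followed back to one; in the other direction it
    ends only at a corner of [peel]. *)
Lemma col_label1 i j j' : i < j -> j <= j' <= n -> e i j = 1 ->
  (exists2 y, j <= y < j' & X i y) \/ e i j' = 1.
Proof.
move=> hij hj; have [d hd] : exists d, j' = j + d by exists (j' - j); lia.
elim: d j hij hd hj => [|d IH] j hij hd hj he; first by right; rewrite hd addn0.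
have := IH j.+1 ltac:(lia) ltac:(lia) ltac:(lia).
case: (growth_cell G (i := i) (j := j)) => [|[hX ? ? ? ?]|[]|[? ? h ?]|[]]; try lia.
  by left; exists j => //; lia.
rewrite -h => /(_ he) [[y hy hX]|]; last by right.
by left; exists y => //; lia.
Qed.

Lemma row_label1 i i' j : i' <= i <= j -> j < n -> f i j = 1 ->
  (exists2 x, i' <= x < i & X x j) \/ f i' j = 1.
Proof.
move=> hi hj; have [d hd] : exists d, i = i' + d by exists (i - i'); lia.
elim: d i hd hi => [|d IH] i hd hi he; first by right; rewrite -he hd addn0.
have [i0 hi0] : exists i0, i = i0.+1 by exists i.-1; lia.
have := IH i0 ltac:(lia) ltac:(lia); rewrite hi0 in he hi *.
case: (growth_cell G (i := i0) (j := j)) => [|[hX ? ? ? ?]|[]|[? ? ? h]|[]]; try lia.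
  by left; exists i0 => //; lia.
rewrite -h => /(_ he) [[y hy hX]|]; last by right.
by left; exists y => //; lia.
Qed.

Lemma row_label1_fwd i i' j : i <= i' <= j -> j < n -> f i j = 1 ->
  (exists2 x, i <= x < i' & peel x j) \/ f i' j = 1.
Proof.
move=> hi hj; have [d hd] : exists d, i' = i + d by exists (i' - i); lia.
elim: d i hd hi => [|d IH] i hd hi he; first by right; rewrite -he hd addn0.
have := IH i.+1 ltac:(lia) ltac:(lia).
case: (growth_cell G (i := i) (j := j)) => [|[? ? ? ? ?]|[? ? h1 ? ?]|[? ? ? h]|[]]; try lia.
  by left; exists i; rewrite /peel -?h1 ?he //; lia.
rewrite h he => /(_ erefl) [[y hy hX]|]; last by right.
by left; exists y => //; lia.
Qed.

Lemma col_label1_fwd i j j' : i < j -> j <= j' <= n -> e i j' = 1 ->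
  (exists2 y, j <= y < j' & peel i y) \/ e i j = 1.
Proof.
move=> hij hj; have [d hd] : exists d, j' = j + d by exists (j' - j); lia.
elim: d j' hd hj => [|d IH] j' hd hj he; first by right; rewrite -he hd addn0.
have [y hy] : exists y, j' = y.+1 by exists j'.-1; lia.
have := IH y ltac:(lia) ltac:(lia); rewrite hy in he *.
case: (growth_cell G (i := i) (j := y)) => [|[? ? ? ? ?]|[? ? h1 ? ?]|[? ? h ?]|[]]; try lia.
  by left; exists y; rewrite /peel ?h1 ?he //; lia.
rewrite h he => /(_ erefl) [[z hz hX]|]; last by right.
by left; exists z => //; lia.
Qed.

(** The label 1 leaving [(x, y)] to the right and the one leaving [(x1, y1)] downwards either meet a
    corner on the way or both reach the cell [(x1, y)], which is then a corner. *)
Lemma peel_between x y x1 y1 : x < x1 -> y < y1 < n -> x1 < y -> X x y -> X x1 y1 ->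
  exists a b, [/\ x < a <= x1, y <= b < y1 & peel a b].
Proof.
move=> hx hy hxy hX hX1.
have hf : f x.+1 y = 1.
  by case: (growth_cell G (i := x) (j := y)) => [|[]|[]|[]|[]]; rewrite ?hX //; lia.
have he : e x1 y1 = 1.
  by case: (growth_cell G (i := x1) (j := y1)) => [|[]|[]|[]|[]]; rewrite ?hX1 //; lia.
case: (row_label1_fwd (i' := x1) _ _ hf) => [||[a ha hp]|hf1]; try lia.
  by exists a, y; split=> //; lia.
case: (col_label1_fwd (j := y.+1) _ _ he) => [||[b hb hp]|he1]; try lia.
  by exists x1, b; split=> //; lia.
by exists x1, y; rewrite /peel hf1 he1; split=> //; lia.
Qed.

(** If no mark is found by following the labels 1 back, up column [a] and left along row [b2], they
    meet in the cell [(a, b2)] and become 2. Labels do not decrease down a column, which contradicts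
    the label 1 above [(a, b)]. *)
Lemma between_peel a b a2 b2 : a < a2 -> b < b2 < n -> a2 < b -> peel a b -> peel a2 b2 ->
  exists u v, [/\ a <= u < a2, b < v <= b2 & X u v].
Proof.
move=> ha hb hab /andP[/eqP he /eqP hf] /andP[/eqP he2 /eqP hf2].
case: (col_label1 (j' := b2.+1) _ _ he) => [||[v hv hX]|he1]; try lia.
  by exists a, v; split=> //; lia.
case: (row_label1 (i' := a) _ _ hf2) => [||[u hu hX]|hf1]; try lia.
  by exists u, b2; split=> //; lia.
have hee : e a b2 = 2.
  by case: (growth_cell G (i := a) (j := b2)) => [|[]|[]|[]|[]]; lia.
suff : forall d, d <= b2 - b.+1 -> 1 < e a (b2 - d).
  by move/(_ (b2 - b.+1) (leqnn _)); rewrite subKn ?he //; lia.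
elim=> [|d IH] hd; first by rewrite subn0 hee.
have := IH ltac:(lia); rewrite (_ : b2 - d = (b2 - d.+1).+1); last by lia.
by case: (growth_cell G (i := a) (j := b2 - d.+1)) => [|[]|[]|[]|[]]; lia.
Qed.

Lemma ne_chain_peel r i x y : i <= y < n -> x < i -> X x y ->
  ne_chain n X r i x.+1 y.+1 -> ne_chain n peel r i x.+1 y.
Proof.
elim: r x y => //= r IH x y hy hx hX [x1 [y1 [hx1 hy1 hX1 hr]]].
have [a [b [ha hb hp]]] := @peel_between x y x1 y1 ltac:(lia) ltac:(lia) ltac:(lia) hX hX1.
exists a, b; split=> //; try lia.
have h := IH x1 y1 ltac:(lia) ltac:(lia) hX1 hr.
by apply: ne_chain_mono h; lia.
Qed.

Lemma peel_ne_chain r i a b : i <= b < n -> a < i -> peel a b ->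
  ne_chain n peel r i a.+1 b.+1 -> ne_chain n X r.+1 i a b.+1.
Proof.
elim: r a b => [|r IH] a b hb ha hp.
  case/andP: hp => /eqP he /eqP hf _.
  have en0 : e a n = 0 by case: G => -> //; lia.
  case: (col_label1 (j' := n) _ _ he) => [||[y hy hX]|]; try lia.
  by exists a, y; split=> //; lia.
move=> [a2 [b2 [ha2 hb2 hp2 hr]]].
have [u [v [hu hv hX]]] := @between_peel a b a2 b2 ltac:(lia) ltac:(lia) ltac:(lia) hp hp2.
exists u, v; split=> //; try lia.
have h := IH a2 b2 ltac:(lia) ltac:(lia) hp2 hr.
by apply: ne_chain_mono h; lia.
Qed.

(** Marks and corners interlace. Between consecutive corners there is a mark, and the labels 1 at
    the end corners lead to one more mark left of the first corner and one above the last. *)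
Lemma ne_chainS_peel r i j : i <= j <= n ->
  ne_chain n X r.+2 i 0 j <-> ne_chain n peel r.+1 i 0 j.
Proof.
move=> hij; split=> [[x [y [hx hy hX hr]]]|[a [b [ha hb hp hr]]]].
  have h := @ne_chain_peel r.+1 i x y ltac:(lia) ltac:(lia) hX hr.
  by apply: ne_chain_mono h; lia.
have := @peel_ne_chain r i a b ltac:(lia) ltac:(lia) hp hr; case/andP: (hp) => /eqP he /eqP hf hX.
have f0 : f 0 b = 0 by case: G => _ -> //; lia.
case: (row_label1 (i' := 0) _ _ hf) => [||[x hx hXx]|]; try lia.
exists x, b; split=> //; try lia.
by apply: ne_chain_mono hX; lia.
Qed.

End Peel.

(** Each peeling removes the first row and shortens the longest chain by one, which reduces the
    claim to a nonempty first row. *)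
Lemma first_colP n X e f r i j : growth n X e f -> i <= j <= n ->
  0 < shape e i j r.+1 <-> ne_chain n X r.+1 i 0 j.
Proof.
elim: r X e f => [|r IH] X e f G hij.
  apply: iff_trans (first_rowP G 1 hij) _.
  by split=> -[x [y [hx hy hX _]]]; exists x, y.
rewrite -shape_peel //; apply: iff_trans (IH _ _ _ (peel_growth G) hij) _.
by apply: iff_sym; apply: ne_chainS_peel.
Qed.

(** * Labels of adjacent columns and of adjacent rows *)

Section Adjacent.

Variables (n : nat) (X : nat -> nat -> bool) (e f : nat -> nat -> nat).
Hypothesis G : growth n X e f.

Lemma growth_col_inj i j j' : i < j < n -> i < j' < n -> X i j -> X i j' -> j = j'.
Proof.
move=> + + h h'; wlog hjj : j j' h h' / j < j'.
  move=> H hj hj'; case: (ltngtP j j') => // hjj; first exact: (H j j').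
  by apply/esym/(H j' j).
move=> hj hj'; have := @col_label_lt_pos _ _ _ _ G i j.+1 j' ltac:(lia) ltac:(lia) h'.
by case: (growth_cell G hj) => -[]; rewrite ?h //; lia.
Qed.

Lemma growth_row_inj i i' j : i < j < n -> i' < j < n -> X i j -> X i' j -> i = i'.
Proof.
move=> + + h h'; wlog hii : i i' h h' / i < i'.
  move=> H hi hi'; case: (ltngtP i i') => // hii; first exact: (H i i').
  by apply/esym/(H i' i).
move=> hi hi'; have := @row_label_pos _ _ _ _ G i i' j ltac:(lia) ltac:(lia) h.
by case: (growth_cell G hi') => -[]; rewrite ?h' //; lia.
Qed.

(** A row that raises the left label to [r] enters the right column with label [r], and so raises
    the right label too if that equals [r]. *)
Lemma col_labels_lt i j j' : i.+1 < j' -> j' <= j <= n ->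
  e i j < e i.+1 j -> e i j' < e i.+1 j'.
Proof.
move=> hi hj; have [d hd] : exists d, j = j' + d by exists (j - j'); lia.
elim: d j' hi hd hj => [|d IH] j' hi hd hj h; first by rewrite (_ : j' = j) //; lia.
have := IH j'.+1 ltac:(lia) ltac:(lia) ltac:(lia) h.
case: (@growth_cell _ _ _ _ G i j') => [|[]|[]|[]|[]]; try lia;
by case: (@growth_cell _ _ _ _ G i.+1 j') => [|[]|[]|[]|[]]; lia.
Qed.

(** Positivity is carried along because a mark may raise the right label from 0 to 1. *)
Lemma col_labels_ge i j j' : i.+1 < j' -> j' <= j <= n -> 0 < e i j ->
  e i.+1 j <= e i j -> 0 < e i j' /\ e i.+1 j' <= e i j'.
Proof.
move=> hi hj; have [d hd] : exists d, j = j' + d by exists (j - j'); lia.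
elim: d j' hi hd hj => [|d IH] j' hi hd hj h h'; first by rewrite (_ : j' = j) //; lia.
have := IH j'.+1 ltac:(lia) ltac:(lia) ltac:(lia) h h'.
case: (@growth_cell _ _ _ _ G i j') => [|[]|[]|[]|[]]; try lia;
by case: (@growth_cell _ _ _ _ G i.+1 j') => [|[]|[]|[]|[]]; lia.
Qed.

Lemma row_labels_lt i i' j : j.+1 < n -> i <= i' <= j ->
  f i j.+1 < f i j -> f i' j.+1 < f i' j.
Proof.
move=> hj hi; have [d hd] : exists d, i' = i + d by exists (i' - i); lia.
elim: d i' hd hi => [|d IH] i' hd hi h; first by rewrite (_ : i' = i) //; lia.
have := IH (i + d) ltac:(lia) ltac:(lia) h; rewrite hd addnS.
case: (@growth_cell _ _ _ _ G (i + d) j) => [|[]|[]|[]|[]]; try lia;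
by case: (@growth_cell _ _ _ _ G (i + d) j.+1) => [|[]|[]|[]|[]]; lia.
Qed.

Lemma row_labels_ge i i' j : j.+1 < n -> i <= i' <= j -> 0 < f i j.+1 ->
  f i j <= f i j.+1 -> 0 < f i' j.+1 /\ f i' j <= f i' j.+1.
Proof.
move=> hj hi; have [d hd] : exists d, i' = i + d by exists (i' - i); lia.
elim: d i' hd hi => [|d IH] i' hd hi h h'; first by rewrite (_ : i' = i) //; lia.
have := IH (i + d) ltac:(lia) ltac:(lia) h h'; rewrite hd addnS.
case: (@growth_cell _ _ _ _ G (i + d) j) => [|[]|[]|[]|[]]; try lia;
by case: (@growth_cell _ _ _ _ G (i + d) j.+1) => [|[]|[]|[]|[]]; lia.
Qed.

Lemma adjacent_openers i y z : i.+1 < y < n -> i.+1 < z < n -> y != z ->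
  X i y -> X i.+1 z -> (forall x, x <= i -> ~~ X x i.+1) ->
  (e i i.+1 < e i.+1 i.+2) = (y < z).
Proof.
move=> hy hz hyz hX hX' hf.
(* Row [i + 1] has no mark up to column [i], so it passes with label 0 and leaves the column label
   unchanged. *)
have -> : e i i.+1 = e i i.+2.
  have f0 : ~ 0 < f i i.+1.
    move/(row_labelP G (i := i) (j := i.+1) ltac:(lia)) => [x hx].
    by apply/negP; apply: hf; lia.
  have := @col_label_lt_pos _ _ _ _ G i i.+2 y ltac:(lia) ltac:(lia) hX.
  by case: (@growth_cell _ _ _ _ G i i.+1) => [|[]|[]|[]|[]]; lia.
(* At the height of the higher mark only its own column has a positive label, and the resulting
   order persists downwards. *)
case: (ltnP y z) hyz => [hlt _|hge neq].
  apply: (col_labels_lt (j := z)); try lia.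
  have -> : e i z = 0.
    apply/eqP; rewrite -leqn0 leqNgt; apply/negP.
    move/(col_labelP G (i := i) (j := z) ltac:(lia)) => [y' hy' hXy'].
    by have := @growth_col_inj i y y' ltac:(lia) ltac:(lia) hX hXy'; lia.
  by case: (@growth_cell _ _ _ _ G i.+1 z) => [|[]|[]|[]|[]]; rewrite ?hX' //; lia.
apply/negbTE; rewrite -leqNgt.
have [||||] // := @col_labels_ge i y i.+2; try lia.
  by apply: (@col_label_lt_pos _ _ _ _ G i y y) => //; lia.
suff -> : e i.+1 y = 0 by [].
apply/eqP; rewrite -leqn0 leqNgt; apply/negP.
move/(col_labelP G (i := i.+1) (j := y) ltac:(lia)) => [y' hy' hXy'].
by have := @growth_col_inj i.+1 z y' ltac:(lia) ltac:(lia) hX' hXy'; lia.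
Qed.

Lemma adjacent_closers j x u : x < j -> u < j -> j.+1 < n -> x != u ->
  X x j -> X u j.+1 -> (forall y, j < y < n -> ~~ X j y) ->
  (f j.+1 j.+1 < f j j) = (x < u).
Proof.
move=> hx hu hj hxu hX hX' he.
have -> : f j.+1 j.+1 = f j j.+1.
  have e0 : ~ 0 < e j j.+2.
    move/(col_labelP G (i := j) (j := j.+2) ltac:(lia)) => [y hy].
    by apply/negP; apply: he; lia.
  have := @row_label_pos _ _ _ _ G u j j.+1 ltac:(lia) ltac:(lia) hX'.
  by case: (@growth_cell _ _ _ _ G j j.+1) => [|[]|[]|[]|[]]; lia.
case: (ltnP x u) hxu => [hlt _|hge neq].
  apply: (row_labels_lt (i := u)); try lia.
  have -> : f u j.+1 = 0.
    apply/eqP; rewrite -leqn0 leqNgt; apply/negP.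
    move/(row_labelP G (i := u) (j := j.+1) ltac:(lia)) => [u' hu' hXu'].
    by have := @growth_row_inj u u' j.+1 ltac:(lia) ltac:(lia) hX' hXu'; lia.
  by apply: (@row_label_pos _ _ _ _ G x u j) => //; lia.
apply/negbTE; rewrite -leqNgt.
have [||||] // := @row_labels_ge u.+1 j j; try lia.
  by apply: (@row_label_pos _ _ _ _ G u u.+1 j.+1) => //; lia.
suff -> : f u.+1 j = 0 by [].
apply/eqP; rewrite -leqn0 leqNgt; apply/negP.
move/(row_labelP G (i := u.+1) (j := j) ltac:(lia)) => [x' hx' hXx'].
by have := @growth_row_inj x x' j ltac:(lia) ltac:(lia) hX hXx'; lia.
Qed.

End Adjacent.

(** * The diagram with given marks *)

Lemma cell_gt0 x a b : (0 < (cell x a b).1 -> x \/ 0 < a) /\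
  (0 < (cell x a b).2 -> x \/ 0 < b).
Proof.
rewrite /cell; case: eqP => [->|_] /=; last by split=> ?; right.
by case: eqP => [_|h] /=; [case: x; split=> //; left | split=> _; right; lia].
Qed.

Section Forward.

Variables (n : nat) (X : nat -> nat -> bool).
Hypothesis Xcol : forall i j j', X i j -> X i j' -> j = j'.
Hypothesis Xrow : forall i i' j, X i j -> X i' j -> i = i'.

(* Row n - 1 - j of the cells is processed at step j. *)
Fixpoint forward_cell i :=
  fix row_cell j : nat * nat :=
    cell (X i (n.-1 - j))
      (if j is j'.+1 then (row_cell j').1 else 0)
      (if i is i'.+1 then (forward_cell i' j).2 else 0).

Lemma forward_cellE i j : forward_cell i j =
  cell (X i (n.-1 - j))
    (if j is j'.+1 then (forward_cell i j').1 else 0)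
    (if i is i'.+1 then (forward_cell i' j).2 else 0).
Proof. by case: i; case: j. Qed.

Definition col_label i j : nat :=
  if j < n then (forward_cell i (n.-1 - j)).1 else 0.

Definition row_label i j : nat :=
  if i is i'.+1 then (forward_cell i' (n.-1 - j)).2 else 0.

Lemma forward_growth : growth n X col_label row_label.
Proof.
have C i j : j < n ->
    (col_label i j, row_label i.+1 j) = cell (X i j) (col_label i j.+1) (row_label i j).
  move=> hj; rewrite {1}/col_label hj /= -surjective_pairing forward_cellE.
  rewrite subKn; last by lia.
  congr cell; rewrite /col_label; case: ifP => h.
  - by rewrite (_ : n.-1 - j = (n.-1 - j.+1).+1) //; lia.
  - by rewrite (_ : n.-1 - j = 0) //; lia.
split=> [i hi|j hj|i j hij|i j hij hX] //; first by rewrite /col_label ltnn.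
  by apply: C; lia.
(* A positive label entering a marked cell would come from a second mark in its column or row. *)
split; apply/eqP; rewrite -leqn0 leqNgt; apply/negP => h.
  suff [y hy hXy] : exists2 y, j.+1 <= y & X i y by have := Xcol hX hXy; lia.
  have [d] : exists d, d = n - j.+1 by exists (n - j.+1).
  elim: d j.+1 h => [|d IH] j' + hd; first by rewrite /col_label ifF //; lia.
  have -> : col_label i j' = (cell (X i j') (col_label i j'.+1) (row_label i j')).1.
    by rewrite -C //; lia.
  case/(cell_gt0 _ _ _).1 => [hXj|h]; first by exists j'.
  by have [|y hy hXy] := IH j'.+1 h; [lia | exists y => //; lia].
suff [x hx hXx] : exists2 x, x < i & X x j by have := Xrow hX hXx; lia.
have hj : j < n by lia.
elim: i h {hij hX} => [|i IH] //.
have -> : row_label i.+1 j = (cell (X i j) (col_label i j.+1) (row_label i j)).2.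
  by rewrite -C.
case/(cell_gt0 _ _ _).2 => [hXj|h]; first by exists i.
by have [x hx hXx] := IH h; exists x => //; lia.
Qed.

End Forward.

(** * The diagram with given labels on the diagonal *)

(** The local rule is invertible: equal positive outputs [r] come from inputs [r - 1], with a mark
    when [r] is 1, and all other outputs equal the inputs. Inversion proceeds away from the
    diagonal. *)
Lemma growth_boundary_inj n X e f X' e' f' :
  growth n X e f -> growth n X' e' f' ->
  (forall p, p < n -> e p p.+1 = e' p p.+1 /\ f p p = f' p p) ->
  forall i j, i < j < n -> X i j = X' i j.
Proof.
move=> G G' hb.
have step i j : i < j < n -> e i j = e' i j -> f i.+1 j = f' i.+1 j ->
    [/\ e i j.+1 = e' i j.+1, f i j = f' i j & X i j = X' i j].
  move=> hij ha hb'; case: (growth_cell G hij) => -[h1 ? ? ?] *;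
  case: (growth_cell G' hij) => -[k1 ? ? ?] *; split; try lia;
  by rewrite ?(negPf h1) ?(negPf k1) ?h1 ?k1 //; lia.
have rec d i : i + d < n ->
    e i (i + d).+1 = e' i (i + d).+1 /\ f i (i + d) = f' i (i + d).
  elim: d i => [|d IH] i hi; first by rewrite addn0; apply: hb; lia.
  have [h1 _] := IH i ltac:(lia); have [_ h2] := IH i.+1 ltac:(lia).
  by have [] := step i (i + d.+1) ltac:(lia); rewrite ?addnS // -?addSn.
move=> i j hij; have [d hd] : exists d, j = i + d.+1 by exists (j - i).-1; lia.
have [h1 _] := rec d i ltac:(lia); have [_ h2] := rec d i.+1 ltac:(lia).
by have [] := step i j ltac:(lia); rewrite ?hd ?addnS // -?addSn.
Qed.

Section Backward.

(** An abstract oscillating tableau: [la p] and [ka p] stand for the partitions at the corners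
    [(p, p)] and [(p, p + 1)]. *)
Variables (n : nat) (E F : nat -> nat) (la ka : nat -> nat -> nat).
Hypothesis la0 : forall k, 0 < k -> la 0 k = 0.
Hypothesis lan : forall k, 0 < k -> la n k = 0.
Hypothesis laF : forall p k, p < n -> 0 < k -> la p k = ka p k + (F p == k).
Hypothesis laE : forall p k, p < n -> 0 < k -> la p.+1 k = ka p k + (E p == k).
Hypothesis la_part : forall p k, p <= n -> 0 < k -> la p k.+1 <= la p k.
Hypothesis ka_part : forall p k, p < n -> 0 < k -> ka p k.+1 <= ka p k.

(* The labels of the edges above and to the left of the cell (i, i + d). *)
Fixpoint backward d i : nat * nat :=
  if d is d'.+1 then
    let a := (backward d' i).1 in let b := (backward d' i.+1).2 in
    if a == b then (a.-1, b.-1) else (a, b)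
  else (E i, F i).

Fixpoint backward_shape d i k : nat :=
  if d is d'.+1 then backward_shape d' i k - ((backward d' i).2 == k) else la i k.

(** [backward_shape d i] belongs to the corner [(i, i + d)]. The delicate case is a cell with equal
    outputs [a]: once a box has been removed from row [a], row [a - 1] is strictly longer, so it can
    lose a box as well. *)
Lemma backward_shapeP d :
  (forall i k, i + d <= n -> 0 < k -> backward_shape d i k.+1 <= backward_shape d i k) /\
  (forall i k, i + d < n -> 0 < k ->
    [/\ backward_shape d.+1 i k + ((backward d i).2 == k) = backward_shape d i k,
        backward_shape d.+1 i k + ((backward d i).1 == k) = backward_shape d i.+1 k
      & backward_shape d.+1 i k.+1 <= backward_shape d.+1 i k]).
Proof.
elim: d => [|d [IHp IH]].
  split=> [i k|i k hi hk] /=; first by rewrite addn0; apply: la_part.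
  rewrite addn0 in hi.
  have := laF hi hk; have := laE hi hk; have := ka_part hi hk.
  by have := laF hi (ltn0Sn k); split; lia.
split=> [i k hi hk|i k hi hk]; first by have [] := IH i k ltac:(lia) hk.
have P := IHp i.+1; have Q := IH i; have R := IH i.+1.
rewrite [backward_shape d.+2 _ _]/= -/(backward_shape d.+1 _ _).
rewrite [backward_shape d.+2 _ _]/= -/(backward_shape d.+1 _ _).
have -> : backward d.+1 i = if (backward d i).1 == (backward d i.+1).2
  then ((backward d i).1.-1, (backward d i.+1).2.-1)
  else ((backward d i).1, (backward d i.+1).2) by [].
move: {IHp IH} (backward d i).1 (backward d i.+1).2 Q R => a b Q R.
set A := backward_shape d.+1 i in Q *; set B := backward_shape d.+1 i.+1 in R *.
set T := backward_shape d i.+1 in P Q R.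
have {}P k' : 0 < k' -> T k'.+1 <= T k' by apply: P; lia.
have {}Q k' : 0 < k' -> A k' + (a == k') = T k' /\ A k'.+1 <= A k'.
  by move=> hk'; case: (Q k' ltac:(lia) hk').
have {}R k' : 0 < k' -> B k' + (b == k') = T k' /\ B k'.+1 <= B k'.
  by move=> hk'; case: (R k' ltac:(lia) hk').
have Pk := P k hk; have [Qk Qk'] := Q k hk; have [Rk Rk'] := R k hk.
have [Q1 _] := Q k.+1 isT; have [R1 _] := R k.+1 isT.
case: (eqVneq a b) => [hab|hab] /=; last by split; lia.
by split; lia.
Qed.

Definition backward_col i j : nat := if i < j then (backward (j - i).-1 i).1 else 0.

Definition backward_row i j : nat := (backward (j - i) i).2.

Definition backward_mark i j : bool :=
  [&& i < j < n, backward_col i j == 1 & backward_row i.+1 j == 1].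

Lemma backward_growth : growth n backward_mark backward_col backward_row.
Proof.
have cellE i j : i < j < n -> let a := backward_col i j in let b := backward_row i.+1 j in
    (backward_col i j.+1, backward_row i j) = if a == b then (a.-1, b.-1) else (a, b).
  move=> hij; rewrite /backward_col /backward_row.
  have [-> ->] : i < j.+1 /\ i < j by lia.
  have [d ->] : exists d, j = i + d.+1 by exists (j - i).-1; lia.
  rewrite (_ : ((i + d.+1).+1 - i).-1 = d.+1); last by lia.
  rewrite (_ : (i + d.+1) - i = d.+1); last by lia.
  by rewrite (_ : (i + d.+1) - i.+1 = d) /=; [case: ifP | lia].
split=> [i hi|j hj|i j hij|i j hij].
- rewrite /backward_col hi.
  (* The partitions at the corners [(n - d, n)] are empty because the one at [(n, n)] is, so no box
     is left for a label on the top edge. *)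
  have S0 k d : 0 < k -> d <= n -> backward_shape d (n - d) k = 0.
    move=> hk; elim: d => [|d IH] hd; first by rewrite subn0 /= lan.
    have := IH ltac:(lia); have [_ /(_ (n - d.+1) k ltac:(lia) hk) [_ h _]] := backward_shapeP d.
    by rewrite (_ : n - d = (n - d.+1).+1); lia.
  case: (posnP (backward (n - i).-1 i).1) => // h.
  have [_ /(_ i _ _ h) [|_ + _]] := backward_shapeP (n - i).-1; first by lia.
  rewrite eqxx prednK; last by lia.
  have := S0 _ (n - i).-1 h ltac:(lia).
  by rewrite (_ : n - (n - i).-1 = i.+1); lia.
- rewrite /backward_row subn0.
  have S0 k d : 0 < k -> d <= n -> backward_shape d 0 k = 0.
    move=> hk; elim: d => [|d IH] hd; first exact: la0.
    by rewrite /= IH ?sub0n; lia.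
  case: (posnP (backward j 0).2) => // h.
  have [_ /(_ 0 _ _ h) [|+ _ _]] := backward_shapeP j; first by lia.
  by rewrite eqxx S0 // S0 //; lia.
- have := cellE i j hij; rewrite /backward_mark hij /=.
  move: (backward_col i j) (backward_row i.+1 j) => a b /=.
  move: (backward_col i j.+1) (backward_row i j) => a' b'.
  rewrite /cell; case: (eqVneq a b) => [<-|hab] [-> ->]; last by rewrite hab.
  by rewrite eqxx; case: a => [|[|a]].
have := cellE i j hij; rewrite /backward_mark => /= hc /and3P[_ /eqP ha /eqP hb].
by move: hc; rewrite ha hb eqxx => -[].
Qed.

Lemma backward_boundary p : backward_col p p.+1 = E p /\ backward_row p p = F p.
Proof. by rewrite /backward_col /backward_row ltnSn subnn subSnn. Qed.

End Backward.

(** * Conjugate partitions and uniqueness of labels *)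

Definition conj_shape n (s : nat -> nat) k : nat := \sum_(1 <= l < n.+1) (k <= s l).

Lemma conj_shapeP n s k l : (forall l, 0 < l -> s l.+1 <= s l) ->
  (forall l, n < l -> s l = 0) -> 0 < k -> 0 < l ->
  (l <= conj_shape n s k) = (k <= s l).
Proof.
move=> hs hn hk hl.
have anti l1 l2 : 0 < l1 -> l1 <= l2 -> s l2 <= s l1.
  move=> h1 /subnKC <-; elim: (l2 - l1) => [|d IH]; first by rewrite addn0.
  by rewrite addnS; apply: leq_trans (hs _ _) IH; lia.
case: (leqP k (s l)) => h.
  have hln : l <= n by rewrite leqNgt; apply/negP => /hn; lia.
  rewrite /conj_shape (big_cat_nat (n := l.+1)) //=.
  apply: leq_trans (leq_addr _ _).
  rewrite (eq_big_nat _ _ (F2 := fun=> 1)) => [|i hi].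
    by rewrite sum_nat_const_nat; lia.
  by have := anti i l ltac:(lia) ltac:(lia); lia.
apply/negbTE; rewrite -ltnNge.
have trunc m : \sum_(1 <= i < m.+1) (k <= s i) <= l.-1.
  elim: m => [|m IH]; first by rewrite big_geq.
  rewrite big_nat_recr //=; case: (leqP l m.+1) => hm.
    by have := anti l m.+1 hl hm; lia.
  have : \sum_(1 <= i < m.+1) (k <= s i) <= m.
    apply: (@leq_trans (\sum_(1 <= i < m.+1) 1)); first by apply: leq_sum => i _; exact: leq_b1.
    by rewrite sum_nat_const_nat; lia.
  by case: (k <= s m.+1); lia.
by have := trunc n; rewrite /conj_shape; lia.
Qed.

Lemma conj_shape_part n s k : conj_shape n s k.+1 <= conj_shape n s k.
Proof. by apply: leq_sum => l _; lia. Qed.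

(** The box added in row [a] lies in column [s a], which is its row in the conjugate. *)
Lemma conj_shape_box n (s t : nat -> nat) a k : 0 < a <= n ->
  (forall l, 0 < l -> s l = t l + (a == l)) ->
  conj_shape n s k = conj_shape n t k + (s a == k).
Proof.
move=> ha hs; rewrite /conj_shape.
rewrite !(big_cat_nat (m := 1) (n := a) (p := n.+1)) /=; try lia.
rewrite !(big_ltn (m := a)); try lia.
rewrite (eq_big_nat _ _ (F2 := fun l => (k <= t l) : nat)); last first.
  by move=> l hl; rewrite hs; [rewrite (_ : a == l = false) ?addn0 //; lia | lia].
rewrite [X in _ + (_ + X)](eq_big_nat _ _ (F2 := fun l => (k <= t l) : nat)); last first.
  by move=> l hl; rewrite hs; [rewrite (_ : a == l = false) ?addn0 //; lia | lia].
by have := hs a; rewrite eqxx; lia.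
Qed.

Lemma growth_uniq n X e f X' e' f' : growth n X e f -> growth n X' e' f' ->
  (forall i j, i < j < n -> X i j = X' i j) ->
  (forall i j, i < j <= n -> e i j = e' i j) /\
  (forall i j, i <= j < n -> f i j = f' i j).
Proof.
move=> G G' hX.
have cellE i j : i < j < n -> e i j.+1 = e' i j.+1 -> f i j = f' i j ->
    e i j = e' i j /\ f i.+1 j = f' i.+1 j.
  case: G G' => _ _ c _ [_ _ c' _] hij he hf.
  by have := c i j hij; rewrite he hf hX // -c' // => -[-> ->].
have col i : (forall j, i <= j < n -> f i j = f' i j) ->
    forall j, i < j <= n -> e i j = e' i j.
  move=> hf j hij; have [d hd] : exists d, d = n - j by exists (n - j).
  elim: d j hd hij => [|d IH] j hd hij.
    rewrite (_ : j = n); last by lia.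
    by have [e0 _ _ _] := G; have [e0' _ _ _] := G'; rewrite e0 ?e0' //; lia.
  have [|//] := @cellE i j ltac:(lia) _ (hf j ltac:(lia)).
  by apply: IH; lia.
have row i : forall j, i <= j < n -> f i j = f' i j.
  elim: i => [|i IH] j hij.
    by have [_ f0 _ _] := G; have [_ f0' _ _] := G'; rewrite f0 ?f0' //; lia.
  have [||//] := @cellE i j ltac:(lia); last by apply: IH; lia.
  by apply: col => [j'|]; [move=> h; apply: IH | lia].
by split=> [i j|i j]; [apply: col (row i) j | apply: row].
Qed.

(** Turns the marks of a diagram, made symmetric, into a matching. *)
Lemma symmetric_functional_perm (T : finType) (R : rel T) :
  (forall p q, R p q = R q p) -> irreflexive R ->
  (forall p q q', R p q -> R p q' -> q = q') ->
  exists m : {perm T}, (forall p, m (m p) = p) /\ (forall p q, p != q -> (m p == q) = R p q).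
Proof.
move=> Rs Ri Rf; pose g p := odflt p [pick q | R p q].
have gR p q : R p q -> g p = q.
  rewrite /g; case: pickP => [q' hq' hq|h hq] /=; first exact: Rf hq' hq.
  by rewrite h in hq.
have gK : involutive g.
  move=> p; rewrite {2}/g; case: pickP => [q hq|h] /=; first by apply: gR; rewrite Rs.
  by rewrite /g; case: pickP => [q|] //; rewrite h.
exists (perm (inv_inj gK)); split=> [p|p q npq]; first by rewrite !permE gK.
rewrite permE; apply/eqP/idP => [|/gR //].
rewrite /g; case: pickP => [q' hq' /= <- //|_ /= hpq].
by rewrite hpq eqxx in npq.
Qed.

(** * The oscillating tableau of a matching *)

Section Tableau.

Variable n : nat.
Implicit Types (m : 'S_n).

Definition arc m (i j : nat) : bool :=
  (i < j) && [exists p : 'I_n, (p == i :> nat) && (m p == j :> nat)].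

Lemma arc_ord m (p q : 'I_n) : arc m p q = (p < q) && (m p == q).
Proof.
rewrite /arc; congr andb; apply/existsP/idP => [[x /andP[/eqP/val_inj -> h]] //|h].
by exists p; rewrite eqxx.
Qed.

Lemma arcP m (i j : nat) : reflect (exists p : 'I_n, [/\ i = p :> nat, j = m p :> nat & p < m p]) (arc m i j).
Proof.
apply: (iffP andP) => [[hij /existsP[p /andP[/eqP hp /eqP h]]]|[p [-> -> h]]].
  by move: hij; rewrite -hp -h => hij; exists p.
by split=> //; apply/existsP; exists p; rewrite !eqxx.
Qed.

Lemma arc_col m i j j' : arc m i j -> arc m i j' -> j = j'.
Proof. by move=> /arcP[p [-> -> _]] /arcP[q [/val_inj -> ->]]. Qed.

Lemma arc_row m i i' j : arc m i j -> arc m i' j -> i = i'.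
Proof. by move=> /arcP[p [-> -> _]] /arcP[q [-> /val_inj/perm_inj ->]]. Qed.

Definition gcol m := col_label n (arc m).
Definition grow m := row_label n (arc m).
Definition opening m p := gcol m p p.+1.
Definition closing m p := grow m p p.
(** The partition at the diagonal corner [(p, p)], with one box for each arc from a point before [p]
    to a point from [p] on. *)
Definition tableau m p k := shape (gcol m) p p k.

Lemma arc_growth m : growth n (arc m) (gcol m) (grow m).
Proof. exact: forward_growth (@arc_col m) (@arc_row m). Qed.

Definition inner_shape m p k := shape (gcol m) p p.+1 k.

Lemma tableau_closing m p k : p < n -> 0 < k ->
  tableau m p k = inner_shape m p k + (closing m p == k).
Proof. by move=> hp hk; apply: (shape_row (arc_growth m)); rewrite ?leqnn. Qed.

Lemma tableau_opening m p k : tableau m p.+1 k = inner_shape m p k + (opening m p == k).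
Proof. exact: shapeSl. Qed.

Lemma tableau_part m p k : p <= n -> 0 < k -> tableau m p k.+1 <= tableau m p k.
Proof. by move=> hp; apply: (shape_partition (arc_growth m)); rewrite leqnn. Qed.

Lemma tableau_anti m p k l : p <= n -> 0 < k <= l -> tableau m p l <= tableau m p k.
Proof.
move=> hp /andP[hk /subnKC <-]; elim: (l - k) => [|d IH]; first by rewrite addn0.
by rewrite addnS; apply: leq_trans (tableau_part _ _ _) IH; lia.
Qed.

Lemma tableau_large m p k : p <= n -> n < k -> tableau m p k = 0.
Proof. by move=> hp; apply: (shape_large (arc_growth m)); rewrite leqnn. Qed.

Lemma tableau_le m p k : tableau m p k <= p.
Proof.
rewrite -[p in _ <= p]card_ord -sum1_card; apply: leq_sum => i _; exact: leq_b1.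
Qed.

Lemma tableau0 m k : tableau m 0 k = 0.
Proof. exact: shape0. Qed.

Lemma tableaun m k : 0 < k -> tableau m n k = 0.
Proof. exact: (shapen (arc_growth m) (leqnn n)). Qed.

(** A boolean with bounded indices, so that [pick] can search for a conjugate; all the partitions
    fit into a square of side [n], hence [conjugateP] can drop the bounds on [k] and [l]. *)
Definition conjugate m m' : bool :=
  [forall p : 'I_n.+1, forall k : 'I_n, forall l : 'I_n,
     (k < tableau m p l.+1) == (l < tableau m' p k.+1)].

Lemma conjugateP m m' : reflect
  (forall p k l, p <= n -> 0 < k -> 0 < l -> (k <= tableau m p l) = (l <= tableau m' p k))
  (conjugate m m').
Proof.
apply: (iffP idP) => [h p k l hp hk hl|h]; last first.
  apply/forallP => p; apply/forallP => k; apply/forallP => l; apply/eqP.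
  by apply: h; rewrite // -ltnS.
case: (leqP k n) => hkn; last first.
  by rewrite (tableau_large m' hp hkn); have := tableau_le m p l; lia.
case: (leqP l n) => hln; last first.
  by rewrite (tableau_large m hp hln); have := tableau_le m' p k; lia.
case: k l hk hl hkn hln => [//|k] [//|l] _ _ hkn hln.
move/forallP/(_ (Ordinal (hp : p < n.+1)))/forallP/(_ (Ordinal hkn)): h.
by move/forallP/(_ (Ordinal hln))/eqP.
Qed.

Lemma conjugate_sym m m' : conjugate m m' -> conjugate m' m.
Proof. by move/conjugateP=> h; apply/conjugateP => p k l hp hk hl; rewrite h. Qed.

Lemma opening_gt0 m (p : 'I_n) : (0 < opening m p) = (p < m p).
Proof.
have P := @col_labelP _ _ _ _ (arc_growth m) p p.+1 ltac:(have := ltn_ord p; lia).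
apply/idP/idP => [/P[y hy /arcP[q [/val_inj -> _]]] //|h].
by apply/P; exists (m p : nat); [have := ltn_ord (m p); lia | rewrite arc_ord h eqxx].
Qed.

Section Involution.

Variable m : 'S_n.
Hypothesis mK : forall p, m (m p) = p.

Lemma closing_gt0 (p : 'I_n) : (0 < closing m p) = (m p < p).
Proof.
have P := @row_labelP _ _ _ _ (arc_growth m) p p ltac:(have := ltn_ord p; lia).
apply/idP/idP => [/P[x hx /arcP[q [hq /val_inj hp hlt]]]|h].
  by rewrite hp mK.
by apply/P; exists (m p : nat); rewrite // arc_ord h mK eqxx.
Qed.

Lemma opening_closing i : i < n -> opening m i = 0 \/ closing m i = 0.
Proof.
move=> hi; have := opening_gt0 m (Ordinal hi); have := closing_gt0 (Ordinal hi).
move: (m _) => q /= hc ho; case: (posnP (opening m i)) => [->|h]; first by left.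
by right; apply/eqP; rewrite -leqn0 leqNgt hc -leqNgt ltnW // -ho.
Qed.

(** For adjacent openers, and likewise for adjacent closers, [m p < m q] means that the arcs
    cross. *)
Lemma openers_cross (p q : 'I_n) : q = p.+1 :> nat -> p < m p -> q < m q ->
  (opening m p < opening m q) = (m p < m q).
Proof.
move=> hpq hp hq; rewrite /opening hpq.
apply: (adjacent_openers (arc_growth m)).
- have := ltn_ord (m p); have : m p <> q by move=> h; move: hq; rewrite -h mK; lia.
  by move/eqP; rewrite -(inj_eq val_inj) /= ; lia.
- by have := ltn_ord (m q); lia.
- by rewrite (inj_eq val_inj) (inj_eq perm_inj) -(inj_eq val_inj) /=; lia.
- by rewrite arc_ord hp eqxx.
- by rewrite -hpq arc_ord hq eqxx.
- move=> x hx; apply/arcP => -[y [hxy h _]].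
  have hyq : m y = q by apply: val_inj; rewrite /= hpq.
  by move: hq; rewrite -hyq mK /= hyq; lia.
Qed.

Lemma closers_cross (p q : 'I_n) : q = p.+1 :> nat -> m p < p -> m q < q ->
  (closing m q < closing m p) = (m p < m q).
Proof.
move=> hpq hp hq; rewrite /closing hpq.
apply: (adjacent_closers (arc_growth m)) => //.
- have : m q <> p by move=> h; move: hp; rewrite -h mK; lia.
  by move/eqP; rewrite -(inj_eq val_inj) /= ; lia.
- by have := ltn_ord q; lia.
- by rewrite (inj_eq val_inj) (inj_eq perm_inj) -(inj_eq val_inj) /=; lia.
- by rewrite arc_ord hp mK eqxx.
- by rewrite -hpq arc_ord hq mK eqxx.
- move=> y hy; apply/arcP => -[x [/val_inj hpx h]].
  by rewrite -hpx; lia.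
Qed.

End Involution.

End Tableau.

(** * Transposing the tableau *)

Section Conjugation.

Variable n : nat.
Implicit Types (m : 'S_n).

Lemma opening_le m p : p < n -> opening m p <= n.
Proof.
move=> hp; apply: (leq_trans (@col_label_le _ _ _ _ (arc_growth m) p p.+1 _)) => //.
by lia.
Qed.

Lemma closing_le m p : p < n -> closing m p <= n.
Proof.
move=> hp; apply: (leq_trans (@row_label_le _ _ _ _ (arc_growth m) p p _)) => //.
  by lia.
exact: ltnW.
Qed.

(** The transposed tableau is the diagonal boundary of a growth diagram, whose marks become the arcs
    of [m']. *)
Lemma conjugate_exists m : (forall p, m (m p) = p) ->
  exists m' : 'S_n, (forall p, m' (m' p) = p) /\ conjugate m m'.
Proof.
move=> mK.
pose la p := conj_shape n (tableau m p); pose ka p := conj_shape n (inner_shape m p).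
(* The box at the end of row [a] has the length of that row as its column, which is its row after
   transposition. *)
pose E p := if opening m p == 0 then 0 else tableau m p.+1 (opening m p).
pose F p := if closing m p == 0 then 0 else tableau m p (closing m p).
have laF p k : p < n -> 0 < k -> la p k = ka p k + (F p == k).
  move=> hp hk; rewrite /la /ka /F; case: (eqVneq (closing m p) 0) => [h0|h0].
    rewrite [0 == k]eq_sym (gtn_eqF hk) addn0; apply: eq_big_nat => l hl.
    by rewrite tableau_closing ?h0 //; lia.
  apply: conj_shape_box; first by rewrite lt0n h0 closing_le.
  by move=> l hl; rewrite tableau_closing.
have laE p k : p < n -> 0 < k -> la p.+1 k = ka p k + (E p == k).
  move=> hp hk; rewrite /la /ka /E; case: (eqVneq (opening m p) 0) => [h0|h0].
    rewrite [0 == k]eq_sym (gtn_eqF hk) addn0; apply: eq_big_nat => l hl.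
    by rewrite tableau_opening ?h0 //; lia.
  apply: conj_shape_box; first by rewrite lt0n h0 opening_le.
  by move=> l hl; rewrite tableau_opening.
have conj0 s k : 0 < k -> (forall l, 0 < l -> s l = 0) -> conj_shape n s k = 0.
  by move=> hk hs; rewrite /conj_shape big_nat big1 // => l hl; rewrite hs //; lia.
have la0 k : 0 < k -> la 0 k = 0 by move=> hk; apply: conj0 => // l _; apply: tableau0.
have lan k : 0 < k -> la n k = 0 by move=> hk; apply: conj0 => // l; apply: tableaun.
have la_part p k : p <= n -> 0 < k -> la p k.+1 <= la p k.
  by move=> _ _; apply: conj_shape_part.
have ka_part p k : p < n -> 0 < k -> ka p k.+1 <= ka p k.
  by move=> _ _; apply: conj_shape_part.
have EF p : p < n -> E p = 0 \/ F p = 0.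
  move=> /(opening_closing mK)[h|h]; [left|right]; by rewrite /E /F h.
pose X := backward_mark n E F.
have G : growth n X (backward_col E F) (backward_row E F).
  exact: (backward_growth la0 lan laF laE la_part ka_part).
have Xlt i j : X i j -> i < j < n by case/and3P.
have Xopen i j : X i j -> 0 < E i.
  move=> h; have hij := Xlt _ _ h; have [<- _] := backward_boundary E F i.
  by apply: (col_label_lt_pos G (y := j)) h; lia.
have Xclose i j : X i j -> 0 < F j.
  move=> h; have hij := Xlt _ _ h; have [_ <-] := backward_boundary E F j.
  by apply: (row_label_pos G (x := i)) h; lia.
pose R := [rel p q : 'I_n | X p q || X q p].
have [|||m' [m'K hm']] := @symmetric_functional_perm _ R.
- by move=> p q /=; rewrite orbC.
- by move=> p /=; rewrite orbb; apply/negP => /Xlt; lia.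
(* At most one of [E i] and [F i] is positive, so no point both opens and closes an arc. *)
- have nXX i j j' : X i j -> X j' i -> False.
    move=> h h'; have := Xlt _ _ h => hij.
    by have := Xopen _ _ h; have := Xclose _ _ h'; case: (EF i); lia.
  move=> p q q' /= /orP[h|h] /orP[h'|h']; apply: val_inj.
  + exact: (growth_col_inj G (Xlt _ _ h) (Xlt _ _ h') h h').
  + by case: (nXX _ _ _ h h').
  + by case: (nXX _ _ _ h' h).
  + exact: (growth_row_inj G (Xlt _ _ h) (Xlt _ _ h') h h').
exists m'; split=> //.
have arcX i j : i < j < n -> arc m' i j = X i j.
  move=> hij; have hi : i < n by lia. have hj : j < n by lia.
  rewrite -[i]/(val (Ordinal hi)) -[j]/(val (Ordinal hj)) arc_ord /=.
  rewrite hm' /=; last by rewrite -(inj_eq val_inj) /=; lia.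
  rewrite (_ : X j i = false) ?orbF; last by apply/negP => /Xlt; lia.
  by rewrite (_ : i < j = true) //; lia.
(* Equal marks force equal labels, so the tableau of [m'] is the prescribed one. *)
have [eqE eqF] := growth_uniq (arc_growth m') G arcX.
have tab p k : p <= n -> 0 < k -> tableau m' p k = la p k.
  move=> + hk; elim: p => [|p IH] hp; first by rewrite tableau0 la0.
  have := IH (ltnW hp); rewrite tableau_opening laE // tableau_closing // laF //.
  have [<- <-] := backward_boundary E F p.
  by rewrite /opening /closing eqE ?eqF; lia.
apply/conjugateP => p k l hp hk hl; rewrite tab // conj_shapeP // => l'.
  exact: tableau_part.
exact: tableau_large.
Qed.

Lemma conjugate_uniq m m1 m2 :
  (forall p, m1 (m1 p) = p) -> (forall p, m2 (m2 p) = p) ->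
  conjugate m m1 -> conjugate m m2 -> m1 = m2.
Proof.
move=> K1 K2 /conjugateP c1 /conjugateP c2.
have tab p l : p <= n -> 0 < l -> tableau m1 p l = tableau m2 p l.
  move=> hp hl; apply/eqP; rewrite eqn_leq.
  case: (posnP (tableau m1 p l)) => h1; case: (posnP (tableau m2 p l)) => h2.
  - by rewrite h1 h2.
  - by have := leqnn (tableau m2 p l); rewrite -c2 // c1 // h1; lia.
  - by have := leqnn (tableau m1 p l); rewrite -c1 // c2 // h2; lia.
  by rewrite -c2 // c1 // leqnn -c1 // c2 // leqnn.
have bd p : p < n -> opening m1 p = opening m2 p /\ closing m1 p = closing m2 p.
  (* Eliminating the inner partitions leaves this identity. It determines the labels because each
     matching has one of its two labels at [p] equal to 0. *)
  move=> hp; have : forall k, 0 < k -> (opening m1 p == k) + (closing m2 p == k) =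
                                  (opening m2 p == k) + (closing m1 p == k).
    move=> k hk; have := tab p k (ltnW hp) hk; have := tab p.+1 k hp hk.
    by rewrite !tableau_opening !tableau_closing //; lia.
  case: (opening_closing K1 hp) (opening_closing K2 hp) => -> [] -> hh.
  - by have := hh (closing m1 p); have := hh (closing m2 p); lia.
  - by have := hh (closing m1 p); have := hh (opening m2 p); lia.
  - by have := hh (opening m1 p); have := hh (closing m2 p); lia.
  - by have := hh (opening m1 p); have := hh (opening m2 p); lia.
have hX := growth_boundary_inj (arc_growth m1) (arc_growth m2) bd.
have opp (p : 'I_n) : p < m1 p -> m1 p = m2 p.
  move=> hp; have := hX p (m1 p) ltac:(have := ltn_ord (m1 p); lia).
  by rewrite !arc_ord hp eqxx /= => /esym/eqP.
apply/permP => p; case: (ltngtP p (m1 p)) => [|h|/val_inj h]; first exact: opp.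
  by apply: (@perm_inj _ m2); rewrite K2 -(opp (m1 p)) K1.
case: (ltngtP p (m2 p)) => [h2|h2|/val_inj <- //].
  have := hX p (m2 p) ltac:(have := ltn_ord (m2 p); lia).
  by rewrite !arc_ord h2 eqxx -h => /eqP.
have := hX (m2 p) p ltac:(have := ltn_ord p; lia).
rewrite !arc_ord h2 K2 eqxx /= => /eqP h3.
by rewrite -{1}h3 K1.
Qed.

Definition conj_matching m : 'S_n :=
  odflt m [pick m' : 'S_n | [forall p, m' (m' p) == p] && conjugate m m'].

Lemma conj_matchingP m : (forall p, m (m p) = p) ->
  (forall p, conj_matching m (conj_matching m p) = p) /\ conjugate m (conj_matching m).
Proof.
move=> mK; rewrite /conj_matching; case: pickP => [m' /andP[/forallP h1 h2]|h] /=.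
  by split=> // p; apply/eqP.
have [m' [h1 h2]] := conjugate_exists mK.
suff : false by []; rewrite -(h m') h2 andbT; apply/forallP => p; apply/eqP/h1.
Qed.

Lemma conj_matchingK m : (forall p, m (m p) = p) -> conj_matching (conj_matching m) = m.
Proof.
move=> mK; have [h1 h2] := conj_matchingP mK; have [h3 h4] := conj_matchingP h1.
exact: (conjugate_uniq h3 mK h4 (conjugate_sym h2)).
Qed.

Section Labels.

Variables m m' : 'S_n.
Hypotheses (mK : forall p, m (m p) = p) (mK' : forall p, m' (m' p) = p).
Hypothesis C : conjugate m m'.

Lemma opening_conjugate p : p < n -> 0 < opening m p ->
  opening m' p = tableau m p.+1 (opening m p).
Proof.
move=> hp h; have cl : closing m p = 0 by case: (opening_closing mK hp); lia.
set a := opening m p in h *; set c := tableau m p.+1 a.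
have c0 : 0 < c by rewrite /c tableau_opening -/a eqxx addn1.
have e1 := tableau_opening m p a; have e2 := tableau_closing m hp h.
rewrite -/a -/c eqxx in e1; rewrite cl [0 == a]eq_sym (gtn_eqF h) in e2.
have h1 := (conjugateP _ _ C) p.+1 c a hp c0 h.
have h2 := (conjugateP _ _ C) p c a (ltnW hp) c0 h.
have := tableau_opening m' p c; have := tableau_closing m' hp c0; lia.
Qed.

Lemma closing_conjugate p : p < n -> 0 < closing m p ->
  closing m' p = tableau m p (closing m p).
Proof.
move=> hp h; have cl : opening m p = 0 by case: (opening_closing mK hp); lia.
set a := closing m p in h *; set c := tableau m p a.
have c0 : 0 < c by rewrite /c tableau_closing // -/a eqxx addn1.
have e1 := tableau_opening m p a; have e2 := tableau_closing m hp h.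
rewrite -/a -/c eqxx in e2; rewrite cl [0 == a]eq_sym (gtn_eqF h) in e1.
have h1 := (conjugateP _ _ C) p.+1 c a hp c0 h.
have h2 := (conjugateP _ _ C) p c a (ltnW hp) c0 h.
have := tableau_opening m' p c; have := tableau_closing m' hp c0; lia.
Qed.

(** A box added right after another lies either strictly below and weakly left of it, or weakly
    above and strictly right of it; transposition exchanges the two cases. *)
Lemma openings_conjugate p : p.+1 < n -> 0 < opening m p -> 0 < opening m p.+1 ->
  (opening m p < opening m p.+1) = ~~ (opening m' p < opening m' p.+1).
Proof.
move=> hp h1 h2; have hp' : p < n by lia.
rewrite (opening_conjugate hp' h1) (opening_conjugate hp h2).
have cl : closing m p.+1 = 0 by case: (opening_closing mK hp); lia.
have cl0 : closing m p = 0 by case: (opening_closing mK hp'); lia.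
set a := opening m p in h1 *; set b := opening m p.+1 in h2 *.
have e1 := tableau_opening m p.+1 b; have e2 := tableau_closing m hp h2.
have e3 := tableau_opening m p b; have e4 := tableau_closing m hp' h2.
have e5 := tableau_opening m p a; have e6 := tableau_closing m hp' h1.
rewrite -/a -/b ?eqxx ?cl ?cl0 in e1 e2 e3 e4 e5 e6.
case: (ltnP a b) => hab.
  have := @tableau_anti n m p a b ltac:(lia) ltac:(lia).
  by lia.
have := @tableau_anti n m p.+1 b a ltac:(lia) ltac:(lia).
by lia.
Qed.

(** Boxes removed in succession are boxes added in the reverse order. *)
Lemma closings_conjugate p : p.+1 < n -> 0 < closing m p -> 0 < closing m p.+1 ->
  (closing m p.+1 < closing m p) = ~~ (closing m' p.+1 < closing m' p).
Proof.
move=> hp h1 h2; have hp' : p < n by lia.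
rewrite (closing_conjugate hp' h1) (closing_conjugate hp h2).
have cl0 : opening m p = 0 by case: (opening_closing mK hp'); lia.
set a := closing m p in h1 *; set b := closing m p.+1 in h2 *.
have e3 := tableau_opening m p b; have e4 := tableau_closing m hp' h2.
have e5 := tableau_opening m p a; have e6 := tableau_closing m hp' h1.
rewrite -/a -/b ?eqxx ?cl0 in e3 e4 e5 e6.
case: (ltnP b a) => hab.
  have := @tableau_anti n m p b a ltac:(lia) ltac:(lia).
  by lia.
have := @tableau_anti n m p.+1 a b ltac:(lia) ltac:(lia).
by lia.
Qed.

Lemma opener_conjugate (p : 'I_n) : p < m p -> p < m' p.
Proof.
rewrite -!opening_gt0 => h; rewrite opening_conjugate //.
by rewrite tableau_opening eqxx addn1.
Qed.

Lemma closer_conjugate (p : 'I_n) : m p < p -> m' p < p.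
Proof.
rewrite -!closing_gt0 // => h; rewrite closing_conjugate //.
by rewrite tableau_closing // eqxx addn1.
Qed.

End Labels.

End Conjugation.

(** * Crossings and nestings as chains *)

Section Chains.

Variables (n : nat) (m : 'S_n).
Implicit Types (s : seq 'I_n).

Lemma increasing_pairwise s : increasing s = pairwise (fun a b : 'I_n => a < b) s.
Proof. by rewrite /increasing sorted_pairwise // => a b c; apply: ltn_trans. Qed.

Lemma crossing_seqP r : reflect
  (exists s, [/\ size s = r, allrel (fun a b : 'I_n => a < m b) s s,
     pairwise (fun a b : 'I_n => a < b) s & pairwise (fun a b : 'I_n => m a < m b) s])
  (has_crossing m r).
Proof.
apply: (iffP existsP) => [[s]|[s [hs h1 h2 h3]]].
  rewrite increasing_pairwise pairwise_cat allrel_mapr pairwise_map => /and3P[h1 h2 h3].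
  by exists s; rewrite size_tuple.
exists (tcast hs (in_tuple s)); rewrite val_tcast /=.
by rewrite increasing_pairwise pairwise_cat allrel_mapr pairwise_map h1 h2 h3.
Qed.

Lemma nesting_seqP r : reflect
  (exists s, [/\ size s = r, allrel (fun a b : 'I_n => a < m b) s s,
     pairwise (fun a b : 'I_n => a < b) s & pairwise (fun a b : 'I_n => m b < m a) s])
  (has_nesting m r).
Proof.
have E s : increasing (s ++ rev (map m s)) = [&& allrel (fun a b : 'I_n => a < m b) s s,
     pairwise (fun a b : 'I_n => a < b) s & pairwise (fun a b : 'I_n => m b < m a) s].
  rewrite increasing_pairwise pairwise_cat -increasing_pairwise.
  rewrite -[pairwise _ (rev _)]increasing_pairwise {2}/increasing rev_sorted.
  rewrite sorted_pairwise; last by move=> a b c h1 h2; apply: ltn_trans h2 h1.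
  rewrite pairwise_map increasing_pairwise; congr andb.
  apply/allrelP/allrelP => h x y hx.
    by move=> hy; apply: h; rewrite // mem_rev map_f.
  by rewrite mem_rev => /mapP[z hz ->]; apply: h.
apply: (iffP existsP) => [[s]|[s [hs h1 h2 h3]]].
  by rewrite E => /and3P[h1 h2 h3]; exists s; rewrite size_tuple.
by exists (tcast hs (in_tuple s)); rewrite val_tcast /= E h1 h2 h3.
Qed.

(** The chain takes the innermost arc first, whereas [s] lists the openers from left to right; hence
    the [rcons]. *)
Lemma se_chain_seqP r i j : i <= j -> se_chain n (arc m) r i j <->
  exists s, [/\ size s = r, all (fun a : 'I_n => (a < i) && (j <= m a)) s,
    pairwise (fun a b : 'I_n => a < b) s & pairwise (fun a b : 'I_n => m b < m a) s].
Proof.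
elim: r i j => [|r IH] i j hij; first by split=> // _; exists [::].
split=> [/= [x [y [hx hy /arcP[p [hxp hyp hp]] hr]]]|[s]].
  have [s [h1 h2 h3 h4]] := (IH x y.+1 ltac:(lia)).1 hr.
  exists (rcons s p); rewrite size_rcons h1 all_rcons !pairwise_rcons h3 h4 !andbT.
  split=> //; first (apply/andP; split; first by lia).
  - by apply: sub_all h2 => a; lia.
  - by apply: sub_all h2 => a; lia.
  - by apply: sub_all h2 => a; lia.
case/lastP: s => [|s p] [] //; rewrite size_rcons all_rcons !pairwise_rcons.
move=> -[hs] /andP[hp ha] /andP[h1 h2] /andP[h3 h4].
exists (p : nat), (m p : nat); split; try by have := ltn_ord (m p); lia.
  by rewrite arc_ord eqxx andbT; lia.
apply/IH; first by lia.
exists s; split=> //; apply/allP => a has.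
by move/allP/(_ a has): h1; move/allP/(_ a has): h3; lia.
Qed.

Lemma ne_chain_seqP r i a b : i <= b -> ne_chain n (arc m) r i a b <->
  exists s, [/\ size s = r, all (fun c : 'I_n => (a <= c < i) && (b <= m c)) s,
    pairwise (fun a b : 'I_n => a < b) s & pairwise (fun a b : 'I_n => m a < m b) s].
Proof.
elim: r a b => [|r IH] a b hib; first by split=> // _; exists [::].
split=> [/= [x [y [hx hy /arcP[p [hxp hyp hp]] hr]]]|[s]].
  have [s [h1 h2 h3 h4]] := (IH x.+1 y.+1 ltac:(lia)).1 hr.
  exists (p :: s); rewrite /= h1 h3 h4 !andbT.
  split=> //; first (apply/andP; split; first by lia).
  - by apply: sub_all h2 => c; lia.
  - by apply: sub_all h2 => c; lia.
  - by apply: sub_all h2 => c; lia.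
case: s => [|p s] [] //= -[hs] /andP[hp ha] /andP[h1 h2] /andP[h3 h4].
exists (p : nat), (m p : nat); split; try by have := ltn_ord (m p); lia.
  by rewrite arc_ord eqxx andbT; lia.
apply/IH; first by lia.
exists s; split=> //; apply/allP => c hc.
by move/allP/(_ c hc): h1; move/allP/(_ c hc): h3; move/allP/(_ c hc): ha; lia.
Qed.

(* A point separating the openers of a chain from its closers. *)
Lemma allrel_cut s : allrel (fun a b : 'I_n => a < m b) s s ->
  exists2 g, g <= n & all (fun a : 'I_n => (a < g) && (g <= m a)) s.
Proof.
move=> /allrelP h; exists (\max_(a <- s) a.+1).
  by apply/bigmax_leqP_seq => a _ _; apply: ltn_ord.
apply/allP => a ha; apply/andP; split; first exact: (@leq_bigmax_seq _ s xpredT (fun a : 'I_n => a.+1) a ha).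
by apply/bigmax_leqP_seq => b hb _; apply: h.
Qed.

Lemma cut_allrel s g : all (fun a : 'I_n => (a < g) && (g <= m a)) s ->
  allrel (fun a b : 'I_n => a < m b) s s.
Proof. by move=> /allP h; apply/allrelP => a b /h + /h; lia. Qed.

(** At a cut [g] all arcs of the nesting are open, so they form a chain at the corner [(g, g)],
    measured there by the first row. Crossings are measured by the number of rows. *)
Lemma has_nestingP r : has_nesting m r <-> exists2 g, g <= n & r <= tableau m g 1.
Proof.
split=> [/nesting_seqP[s [hs /allrel_cut[g hg hc] h2 h3]]|[g hg]].
  exists g => //; apply/(first_rowP (arc_growth m)); first by lia.
  by apply/se_chain_seqP => //; exists s.
have hgg : g <= g <= n by rewrite leqnn.
move/(first_rowP (arc_growth m) r hgg)/(se_chain_seqP _ (leqnn g)) => [s [h1 h2 h3 h4]].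
by apply/nesting_seqP; exists s; split=> //; apply: cut_allrel h2.
Qed.

Lemma has_crossingP r : 0 < r ->
  has_crossing m r <-> exists2 g, g <= n & 0 < tableau m g r.
Proof.
case: r => // r _.
split=> [/crossing_seqP[s [hs /allrel_cut[g hg hc] h2 h3]]|[g hg]].
  exists g => //; apply/(first_colP _ (arc_growth m)); first by lia.
  by apply/ne_chain_seqP => //; exists s.
have hgg : g <= g <= n by rewrite leqnn.
move/(first_colP r (arc_growth m) hgg)/(ne_chain_seqP _ _ (leqnn g)) => [s [h1 h2 h3 h4]].
by apply/crossing_seqP; exists s; split=> //; apply: cut_allrel h2.
Qed.

End Chains.

Lemma has_crossing_conjugate n (m m' : 'S_n) r : conjugate m m' ->
  has_crossing m r = has_nesting m' r.
Proof.
move=> /conjugateP C; case: (posnP r) => [->|hr].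
  transitivity true; first by apply/crossing_seqP; exists [::].
  by apply/esym/nesting_seqP; exists [::].
apply/idP/idP => [/has_crossingP [] // g hg h|/has_nestingP[g hg h]].
  by apply/has_nestingP; exists g; rewrite // -C.
by apply/has_crossingP => //; exists g; rewrite // C.
Qed.

Lemma crn_conjugate n (m m' : 'S_n) : conjugate m m' -> crn m = nest m'.
Proof. by move=> C; apply: eq_bigl => r; apply: has_crossing_conjugate. Qed.

(** * Sorting permutations *)

Lemma monotone_perm1 n (s : 'S_n) : (forall p q : 'I_n, p < q -> s p < s q) -> s = 1%g.
Proof.
move=> hs; have hs' p q : (s p < s q) = (p < q).
  case: (ltngtP p q) => [/hs //|/hs h|/val_inj ->]; last by rewrite ltnn.
  by apply/negbTE; rewrite -leqNgt ltnW.
have cardI (p : 'I_n) : #|[set q : 'I_n | q < p]| = p.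
  rewrite -sum1_card (eq_bigl (fun q : 'I_n => q < p)) => [|q]; last by rewrite inE.
  by rewrite -(big_ord_widen n (fun=> 1)) ?sum1_card ?card_ord // ltnW.
apply/permP => p; rewrite perm1; apply: val_inj; rewrite /= -[LHS]cardI -[RHS]cardI.
rewrite -(card_imset [set q : 'I_n | q < p] (@perm_inj _ s)).
congr #|pred_of_set _|; apply/setP => x; rewrite inE.
by rewrite -[x](permKV s) (mem_imset _ _ (@perm_inj _ s)) inE hs'.
Qed.

Definition order_perm n (r : rel 'I_n) : 'S_n :=
  odflt 1%g [pick s : 'S_n | [forall p, forall q, (s p < s q) == r p q]].

Lemma order_permP n (r : rel 'I_n) : (forall p, ~~ r p p) ->
  (forall q p p', r p q -> r q p' -> r p p') -> (forall p q, p != q -> r p q || r q p) ->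
  forall p q, (order_perm r p < order_perm r q) = r p q.
Proof.
move=> ri rt rtot.
suff [s hs] : exists s : 'S_n, forall p q, (s p < s q) = r p q.
  rewrite /order_perm; case: pickP => [s' /forallP hs' p q|/(_ s) /forallP[]] /=.
    by move/forallP/(_ q)/eqP: (hs' p).
  by move=> p; apply/forallP => q; rewrite hs.
pose c p := #|[set q | r q p]|.
have cn p : c p < n.
  rewrite -[X in _ < X]card_ord -cardsT; apply: proper_card.
  by rewrite properT; apply/eqP => /setP/(_ p); rewrite !inE (negbTE (ri p)).
have cr p q : r p q -> c p < c q.
  move=> h; apply: proper_card; apply/properP; split.
    by apply/subsetP => x; rewrite !inE => /rt; apply.
  by exists p; rewrite !inE.
have cE p q : (c p < c q) = r p q.
  apply/idP/idP => [h|]; last exact: cr.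
  have npq : p != q by apply: contraL h => /eqP ->; rewrite ltnn.
  case/orP: (rtot _ _ npq) => // /cr; lia.
have ci : injective (fun p => Ordinal (cn p)).
  move=> p q /(congr1 val) /= h; apply/eqP; apply/negPn/negP => /rtot.
  by rewrite -!cE h ltnn.
by exists (perm ci) => p q; rewrite !permE /= cE.
Qed.

(** The set where [f] is below [c] and its image under [s] have the same size; the hypotheses make
    them comparable, hence equal. *)
Lemma sorting_perm_level n (f : 'I_n -> nat) (s : 'S_n) :
  (forall p q : 'I_n, p <= q -> f p <= f q) ->
  (forall p q, f p < f q -> s p < s q) -> forall p, f (s p) = f p.
Proof.
move=> fmono smono.
pose A c := [set x | f x < c]; pose B c := s @: A c.
have memB c p : (s p \in B c) = (f p < c) by rewrite mem_imset ?inE //; apply: perm_inj.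
have AB c : A c = B c.
  suff h : (A c \subset B c) || (B c \subset A c).
    have cAB : #|B c| = #|A c| by apply: card_imset; apply: perm_inj.
    by apply/eqP; case/orP: h => h; last rewrite eq_sym; rewrite eqEcard h cAB leqnn.
  rewrite -implyNb; apply/implyP => /subsetPn[x hx nhx]; apply/subsetP => y hy.
  rewrite -[x](permKV s) memB -leqNgt in nhx; rewrite -[y](permKV s) memB in hy.
  rewrite !inE in hx *; have := smono _ _ (leq_trans hy nhx); rewrite !permKV => /ltnW/fmono.
  by move=> h; apply: leq_ltn_trans h hx.
move=> p; have E c : (f (s p) < c) = (f p < c) by rewrite -(memB c p) -AB inE.
by apply/eqP; rewrite eqn_leq -ltnS E ltnSn -ltnS -E ltnSn.
Qed.

(** * Types of points and the two descent sets *)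

Section Types.

Variable n : nat.
Implicit Types (m : 'S_n) (w : nat -> nat) (K : {set 'I_n.-1}).

(* Closers, openers and fixed points have types 0, 1 and 2. *)
Definition ptype m (p : 'I_n) : nat := if m p < p then 0 else if p < m p then 1 else 2.

(* No descent from p to q when the types are ordered by w and, among openers and among
   closers, crossings are the descents. *)
Definition ascent w m (p q : 'I_n) : bool :=
  (w (ptype m p) < w (ptype m q)) ||
  (ptype m p == ptype m q) && ((ptype m p == 2) || (m q < m p)).

Definition descents w m : {set 'I_n.-1} := [set i | ~~ ascent w m (lo i) (hi i)].

(** The weight for closer < fixed < opener; the identity is the weight for closer < opener <
    fixed. *)
Definition swap12 t := if t == 1 then 2 else if t == 2 then 1 else t.

Lemma neq_val (m : 'S_n) (p q : 'I_n) : p < q -> m p <> m q :> nat.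
Proof. by move=> h /val_inj/perm_inj hpq; rewrite hpq ltnn in h. Qed.

(** An opener followed by a closer always counts, since the two are matched or their arcs cross; a
    closer followed by an opener never does. *)
Lemma MDesE m : (forall p, m (m p) = p) -> MDes m = descents id m.
Proof.
move=> mK; apply/setP => i; rewrite !inE.
have hab : hi i = (lo i).+1 :> nat by [].
move: (lo i) (hi i) hab => a b hab.
have e1 : (m a == b) = (m b == a) by apply/eqP/eqP => [<-|<-]; rewrite mK.
have e2 : m a <> m b :> nat by apply: neq_val; lia.
rewrite /matched /arcs_cross /ascent /ptype.
move: e1; rewrite -!(inj_eq val_inj) /=.
move: (nat_of_ord (m a)) (nat_of_ord (m b)) e2 => x y e2 e1.
case: (ltngtP x a) => hx; case: (ltngtP y b) => hy; rewrite /=; lia.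
Qed.

(** Conjugation keeps the types. Neighbours of different types are compared by [m'] in the order
    closer < fixed < opener; for two openers or two closers, a descent of [m'] is a nesting, hence a
    crossing of [m]. *)
Lemma Des_conjugate m m' : (forall p, m (m p) = p) -> (forall p, m' (m' p) = p) ->
  conjugate m m' -> Des m' = descents swap12 m.
Proof.
move=> mK mK' C; have C' := conjugate_sym C; apply/setP => i; rewrite !inE.
have hab : hi i = (lo i).+1 :> nat by [].
move: (lo i) (hi i) hab => a b hab.
have ab : a < b by lia.
have := @neq_val m a b ab; have := @neq_val m' a b ab.
have o1 := opener_conjugate mK C (p := a); have o2 := opener_conjugate mK C (p := b).
have o3 := opener_conjugate mK' C' (p := a); have o4 := opener_conjugate mK' C' (p := b).
have c1 := closer_conjugate mK mK' C (p := a); have c2 := closer_conjugate mK mK' C (p := b).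
have c3 := closer_conjugate mK' mK C' (p := a); have c4 := closer_conjugate mK' mK C' (p := b).
have oo : a < m a -> b < m b -> (m a < m b) = ~~ (m' a < m' b).
  move=> ha hb; have := openings_conjugate mK C (p := a).
  rewrite -hab !opening_gt0 => /(_ (ltn_ord b) ha hb).
  by rewrite !openers_cross //; [apply: o1 | apply: o2].
have cc : m a < a -> m b < b -> (m a < m b) = ~~ (m' a < m' b).
  move=> ha hb; have := closings_conjugate mK C (p := a).
  rewrite -hab !closing_gt0 // => /(_ (ltn_ord b) ha hb).
  by rewrite !closers_cross //; [apply: c1 | apply: c2].
rewrite /ascent /ptype.
move: (nat_of_ord (m a)) (nat_of_ord (m b)) (nat_of_ord (m' a)) (nat_of_ord (m' b))
  o1 o2 o3 o4 c1 c2 c3 c4 oo cc => x y x' y' o1 o2 o3 o4 c1 c2 c3 c4 oo cc.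
case: (ltngtP x a) oo cc o1 o3 c1 c3 => hx oo cc o1 o3 c1 c3;
case: (ltngtP y b) oo cc o2 o4 c2 c4 => hy oo cc o2 o4 c2 c4; rewrite /= /swap12 /=; lia.
Qed.

End Types.

(** * Sorting the blocks between cuts *)

Section Sorting.

Variable n : nat.
Implicit Types (m : 'S_n) (w : nat -> nat) (K : {set 'I_n.-1}).

(* K cuts [n] after each of its elements; [block K] numbers the resulting intervals. *)
Definition block K (p : 'I_n) : nat := #|[set i in K | (i : nat) < p]|.

Lemma block_mono K (p q : 'I_n) : p <= q -> block K p <= block K q.
Proof.
move=> h; apply: subset_leq_card; apply/subsetP => i; rewrite !inE => /andP[-> hi] /=.
exact: leq_trans hi h.
Qed.

Lemma block_hi K i : (block K (lo i) == block K (hi i)) = (i \notin K).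
Proof.
have E : [set j in K | j < hi i] =
    if i \in K then i |: [set j in K | j < lo i] else [set j in K | j < lo i].
  case: ifP => hi; apply/setP => j; rewrite !inE /=.
    rewrite ltnS leq_eqVlt (inj_eq val_inj).
    by case: eqP => [->|_] //=; rewrite hi.
  rewrite ltnS leq_eqVlt (inj_eq val_inj).
  by case: eqP => [->|_] //=; rewrite hi.
rewrite /block E; case: ifP => hi; last by rewrite eqxx.
by rewrite cardsU1 !inE /= ltnn andbF /= add1n; apply/negbTE; rewrite neq_ltn ltnSn.
Qed.

Lemma ascent_trans w m : injective w ->
  forall q p r : 'I_n, ascent w m p q -> ascent w m q r -> ascent w m p r.
Proof.
move=> wi q p r; rewrite /ascent => /orP[h1|/andP[/eqP e1 h1]] /orP[h2|/andP[/eqP e2 h2]].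
- by rewrite (ltn_trans h1 h2).
- by rewrite -e2 h1.
- by rewrite e1 h2.
rewrite e1 e2 eqxx /=; rewrite e1 in h1; rewrite e2 in h1 h2.
by apply/orP; right; case: eqP h1 h2 => //= _ h1 h2; apply: ltn_trans h2 h1.
Qed.

Lemma descents_sub w m K : injective w ->
  descents w m \subset K ->
  forall p q : 'I_n, p < q -> block K p = block K q -> ascent w m p q.
Proof.
move=> wi /subsetP hK.
have step i : block K (lo i) = block K (hi i) -> ascent w m (lo i) (hi i).
  by move/eqP; rewrite block_hi; apply: contraR => h; apply: hK; rewrite inE.
(* The second alternative absorbs the truncated subtraction when [q <= p]. *)
move=> p q; have [d hd] : exists d, q = p + d.+1 :> nat \/ q <= p.
  by exists (q - p).-1; lia.
elim: d q hd => [|d IH] q hd hpq hb; case: hd => hd; try lia.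
  have hp : p < n.-1 by have := ltn_ord q; lia.
  have e1 : p = lo (Ordinal hp) by apply: val_inj.
  have e2 : q = hi (Ordinal hp) by apply: val_inj => /=; lia.
  by rewrite e1 e2 in hb *; apply: step.
have hq : q.-1 < n.-1 by have := ltn_ord q; lia.
have e2 : q = hi (Ordinal hq) by apply: val_inj => /=; lia.
have hlt : p < lo (Ordinal hq) by rewrite /=; lia.
have b1 : block K p <= block K (lo (Ordinal hq)) by apply: block_mono; lia.
have b2 : block K (lo (Ordinal hq)) <= block K q by apply: block_mono; rewrite /=; lia.
apply: (@ascent_trans _ _ wi (lo (Ordinal hq))).
  by apply: IH => //; [left; rewrite /=; lia | lia].
have := step (Ordinal hq); rewrite -e2; apply; lia.
Qed.

Lemma sub_descents w m K :
  (forall p q : 'I_n, p < q -> block K p = block K q -> ascent w m p q) ->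
  descents w m \subset K.
Proof.
move=> h; apply/subsetP => i; rewrite inE; apply: contraR => hi.
by apply: h; rewrite /= ?ltnSn //; apply/eqP; rewrite block_hi.
Qed.

Definition precedes w m K (p q : 'I_n) : bool :=
  (block K p < block K q) || (block K p == block K q) &&
  ((w (ptype m p) < w (ptype m q)) || (ptype m p == ptype m q) && (p < q)).

Definition sort_perm w m K : 'S_n := order_perm (precedes w m K).

(** Conjugation in the group relabels the points, so every arc moves along with its endpoints. *)
Definition sort_blocks w K m : 'S_n := (m ^ sort_perm w m K)%g.

Lemma sort_permE w m K : injective w ->
  forall p q, (sort_perm w m K p < sort_perm w m K q) = precedes w m K p q.
Proof.
move=> wi; apply: order_permP => [p|q p r|p q npq].
- by rewrite /precedes !ltnn andbF andbF.
- by rewrite /precedes -!(inj_eq wi (ptype m _)); lia.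
have npq' : p != q :> nat by rewrite (inj_eq val_inj).
by rewrite /precedes -!(inj_eq wi (ptype m _)); lia.
Qed.

Section Sort.

Variables (w w' : nat -> nat) (K : {set 'I_n.-1}) (m : 'S_n).
Hypotheses (wi : injective w) (wi' : injective w') (w01 : w 0 < w 1) (w01' : w' 0 < w' 1).
Hypothesis mK : forall p, m (m p) = p.
Hypothesis mD : descents w m \subset K.

Let s := sort_perm w' m K.
Let m' := sort_blocks w' K m.

Let asc : forall p q : 'I_n, p < q -> block K p = block K q -> ascent w m p q.
Proof. exact: descents_sub. Qed.

Lemma block_sort_perm p : block K (s p) = block K p.
Proof.
apply: sorting_perm_level => [q r|q r h]; first exact: block_mono.
by rewrite (sort_permE _ _ wi') /precedes h.
Qed.

Lemma sort_blocksE p : m' (s p) = s (m p).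
Proof. exact: permJ. Qed.

Lemma ptype_fixed p : (ptype m p == 2) = (m p == p).
Proof. by rewrite /ptype -(inj_eq val_inj) /=; case: (ltngtP (m p) p). Qed.

(** Within a block the closers already precede the openers, and [w'] agrees with [w] on this, so
    matched points never pass each other. *)
Lemma sort_perm_matched p q : m p != p -> m q != q -> (s p < s q) = (p < q).
Proof.
have mono p1 q1 : m p1 != p1 -> m q1 != q1 -> p1 < q1 -> s p1 < s q1.
  rewrite -!ptype_fixed => hp hq h; rewrite (sort_permE _ _ wi') /precedes.
  have := block_mono K (ltnW h); rewrite leq_eqVlt => /orP[/eqP hb|->] //.
  rewrite hb ltnn eqxx /=.
  have := asc h hb; rewrite /ascent h; move: hp hq; rewrite /ptype.
  by case: (ltngtP (m p1) p1); case: (ltngtP (m q1) q1) => //=; rewrite ?w01' ?orbT //; lia.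
move=> hp hq; case: (ltngtP p q) => [|h|/val_inj ->]; last by rewrite ltnn.
  exact: mono.
by apply/negbTE; rewrite -leqNgt ltnW // mono.
Qed.

Lemma matched_image p : (m (m p) != m p) = (m p != p).
Proof. by rewrite (inj_eq perm_inj). Qed.

Lemma ptype_sort p : ptype m' (s p) = ptype m p.
Proof.
rewrite /ptype sort_blocksE; case: (eqVneq (m p) p) => [->|h]; first by rewrite !ltnn.
by rewrite !sort_perm_matched ?matched_image.
Qed.

Lemma sort_blocks_invol p : m' (m' p) = p.
Proof. by rewrite -[p](permKV s) !sort_blocksE mK. Qed.

(** Points of equal type keep their relative order, as do their partners, so ascents within a type
    survive. *)
Lemma sort_blocks_descents : descents w' m' \subset K.
Proof.
apply: sub_descents => x y; rewrite -[x](permKV s) -[y](permKV s).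
move: (_ x) (_ y) => p q; rewrite (sort_permE _ _ wi') !block_sort_perm => + hb.
rewrite /precedes hb ltnn eqxx /= /ascent !ptype_sort => /orP[->|/andP[/eqP ht h]] //.
rewrite ht ltnn eqxx /=; have := asc h hb; rewrite /ascent ht ltnn eqxx /=.
case: (eqVneq (ptype m q) 2) => //= hq.
have hp : ptype m p != 2 by rewrite ht.
rewrite ptype_fixed in hp; rewrite ptype_fixed in hq.
by rewrite !sort_blocksE sort_perm_matched ?matched_image.
Qed.

Lemma sort_blocks_fixed : #|[set p | m' p == p]| = #|[set p | m p == p]|.
Proof.
rewrite -(card_imset [set p | m p == p] (@perm_inj _ s)); congr #|pred_of_set _|.
apply/setP => x; rewrite -[x](permKV s) (mem_imset _ _ (@perm_inj _ s)) !inE.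
by rewrite sort_blocksE (inj_eq perm_inj).
Qed.

Lemma sort_perm_chain (l : seq 'I_n) :
  allrel (fun a b : 'I_n => a < m b) l l ->
  [/\ allrel (fun a b : 'I_n => a < m' b) (map s l) (map s l),
      pairwise (fun a b : 'I_n => a < b) l -> pairwise (fun a b : 'I_n => a < b) (map s l),
      pairwise (fun a b : 'I_n => m a < m b) l ->
        pairwise (fun a b : 'I_n => m' a < m' b) (map s l)
    & pairwise (fun a b : 'I_n => m b < m a) l ->
        pairwise (fun a b : 'I_n => m' b < m' a) (map s l)].
Proof.
move=> /allrelP h1.
have hm p : p \in l -> m p != p.
  by move=> hp; have := h1 p p hp hp; rewrite -(inj_eq val_inj) /=; lia.
have pw (R R' : rel 'I_n) : (forall p q, p \in l -> q \in l -> R p q -> R' (s p) (s q)) ->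
    pairwise R l -> pairwise R' (map s l).
  move=> hR; rewrite pairwise_map; apply: (sub_in_pairwise (P := mem l)) (allss l) => p q.
  exact: hR.
split; last 3 first.
- by apply: pw => p q hp hq; rewrite sort_perm_matched ?hm.
- by apply: pw => p q hp hq; rewrite !sort_blocksE sort_perm_matched ?matched_image ?hm.
- by apply: pw => p q hp hq; rewrite !sort_blocksE sort_perm_matched ?matched_image ?hm.
apply/allrelP => _ _ /mapP[p hp ->] /mapP[q hq ->].
by rewrite sort_blocksE sort_perm_matched ?matched_image ?hm ?h1.
Qed.

Lemma sort_blocks_crossing r : has_crossing m r -> has_crossing m' r.
Proof.
move/crossing_seqP => [l [hl /sort_perm_chain[k1 k2 k3 _] h2 h3]]; apply/crossing_seqP.
by exists (map s l); rewrite size_map k1 k2 // k3.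
Qed.

Lemma sort_blocks_nesting r : has_nesting m r -> has_nesting m' r.
Proof.
move/nesting_seqP => [l [hl /sort_perm_chain[k1 k2 _ k3] h2 h3]]; apply/nesting_seqP.
by exists (map s l); rewrite size_map k1 k2 // k3.
Qed.

(** The product of the two sorting permutations is increasing, hence the identity. *)
Lemma sort_blocksK : sort_blocks w K m' = m.
Proof.
pose s' := sort_perm w m' K.
suff h : (s * s' = 1)%g by rewrite /sort_blocks -/s' /m' /sort_blocks -/s -conjgM h conjg1.
apply: monotone_perm1 => p q h; rewrite !permM (sort_permE _ _ wi) /precedes !block_sort_perm !ptype_sort.
have := block_mono K (ltnW h); rewrite leq_eqVlt => /orP[/eqP hb|->] //.
rewrite hb ltnn eqxx /=; have := asc h hb; rewrite /ascent => /orP[-> //|/andP[/eqP ht _]].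
by rewrite ht ltnn eqxx /= (sort_permE _ _ wi') /precedes hb ht !ltnn !eqxx h.
Qed.

End Sort.

End Sorting.

(** * Summation over descent sets *)

Import GRing.Theory.
Local Open Scope ring_scope.

(** Moebius inversion: by induction on the size, the terms of the proper subsets of [K] cancel. *)
Lemma subset_sum_inj (V : zmodType) (I : finType) (f g : {set I} -> V) :
  (forall K : {set I}, \sum_(J : {set I} | J \subset K) f J = \sum_(J : {set I} | J \subset K) g J) ->
  f =1 g.
Proof.
move=> h K; move: {2}#|K|.+1 (ltnSn #|K|) => c.
elim: c K => // c IH K hK; have := h K.
rewrite (bigD1 K) //= [RHS](bigD1 K) //=.
rewrite [X in _ + X = _](eq_bigr g); first by move/addIr.
move=> J /andP[hJ nJ]; apply: IH.
have := proper_card (_ : J \proper K); rewrite properEneq nJ hJ => /(_ isT); lia.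
Qed.

Lemma matchingsP n k (m : 'S_n) :
  reflect ((forall p, m (m p) = p) /\ #|[set p | m p == p]| = k) (m \in matchings n k).
Proof.
rewrite inE; apply: (iffP andP) => -[h1 h2]; split; try exact/eqP.
  by move=> p; apply/eqP; move/forallP: h1.
by apply/forallP => p; apply/eqP.
Qed.

Lemma sum_descents_sub (V : nmodType) n k (F : nat -> nat -> V) (w w' : nat -> nat)
    (K : {set 'I_n.-1}) :
  injective w -> injective w' -> (w 0 < w 1)%N -> (w' 0 < w' 1)%N ->
  \sum_(m in matchings n k | descents w m \subset K) F (crn m) (nest m) =
  \sum_(m in matchings n k | descents w' m \subset K) F (crn m) (nest m).
Proof.
move=> wi wi' w01 w01'.
pose good v (m : 'S_n) := (m \in matchings n k) && (descents v m \subset K).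
have sort_good v v' m : injective v -> injective v' -> (v 0 < v 1)%N -> (v' 0 < v' 1)%N ->
    good v m -> good v' (sort_blocks v' K m).
  move=> vi vi' v01 v01' /andP[/matchingsP[mK mk] mD]; apply/andP; split.
    by apply/matchingsP; split; [move=> p; rewrite sort_blocks_invol | rewrite sort_blocks_fixed].
  exact: (sort_blocks_descents vi).
have sortK v v' m : injective v -> injective v' -> (v 0 < v 1)%N -> (v' 0 < v' 1)%N ->
    good v m -> sort_blocks v K (sort_blocks v' K m) = m.
  by move=> vi vi' v01 v01' /andP[/matchingsP[mK mk] mD]; apply: sort_blocksK.
have sort_stat v v' m : injective v -> injective v' -> (v 0 < v 1)%N -> (v' 0 < v' 1)%N ->
    good v m -> crn (sort_blocks v' K m) = crn m /\ nest (sort_blocks v' K m) = nest m.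
  move=> vi vi' v01 v01' gm; have gm' := sort_good _ _ _ vi vi' v01 v01' gm.
  have mm := sortK _ _ _ vi vi' v01 v01' gm.
  case/andP: gm => /matchingsP[mK mk] mD; case/andP: gm' => /matchingsP[mK' mk'] mD'.
  (* Sorting preserves chains; the converse follows by sorting back. *)
  split; apply: eq_bigl => r; apply/idP/idP.
  - by move/(sort_blocks_crossing vi' vi v01' v01 mD'); rewrite mm.
  - exact: (sort_blocks_crossing vi vi' v01 v01' mD).
  - by move/(sort_blocks_nesting vi' vi v01' v01 mD'); rewrite mm.
  - exact: (sort_blocks_nesting vi vi' v01 v01' mD).
rewrite (reindex_onto (sort_blocks w K) (sort_blocks w' K)) => [|m gm]; last exact: sortK.
apply: eq_big => [m|m /andP[gm /eqP hm]].
  rewrite -/(good w _) -/(good w' _); apply/andP/idP => [[gm /eqP <-]|gm].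
    exact: (sort_good w).
  by rewrite (sort_good w') // (sortK w').
have gm' : good w' m by rewrite -hm; apply: (sort_good w).
by have [-> ->] := sort_stat _ _ _ wi' wi w01' w01 gm'.
Qed.

Lemma descents_equidistributed (S : comPzRingType) n k (F : nat -> nat -> S)
    (x : {set 'I_n.-1} -> S) (w w' : nat -> nat) :
  injective w -> injective w' -> (w 0 < w 1)%N -> (w' 0 < w' 1)%N ->
  \sum_(m in matchings n k) F (crn m) (nest m) * x (descents w m) =
  \sum_(m in matchings n k) F (crn m) (nest m) * x (descents w' m).
Proof.
move=> wi wi' w01 w01'.
have E v : \sum_(m in matchings n k) F (crn m) (nest m) * x (descents v m) =
    \sum_J (\sum_(m in matchings n k | descents v m == J) F (crn m) (nest m)) * x J.
  rewrite (partition_big (descents v) predT) //=; apply: eq_bigr => J _.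
  by rewrite mulr_suml; apply: eq_bigr => m /andP[_ /eqP ->].
rewrite !E; apply: eq_bigr => J _; congr (_ * _); move: J; apply: subset_sum_inj => K.
have E' v : \sum_(J : {set 'I_n.-1} | J \subset K)
      \sum_(m in matchings n k | descents v m == J) F (crn m) (nest m) =
    \sum_(m in matchings n k | descents v m \subset K) F (crn m) (nest m).
  rewrite [RHS](partition_big (descents v) (fun J : {set 'I_n.-1} => J \subset K)) /=; last first.
    by move=> m /andP[].
  apply: eq_bigr => J hJ; apply: eq_bigl => m.
  by case: eqP => [->|]; rewrite ?andbF ?hJ ?andbT.
by rewrite !E'; apply: sum_descents_sub.
Qed.

Theorem theorem6p6 (n k : nat) (hkn : (k <= n)%N) (hpar : ~~ odd (n - k)%N) :
  \sum_(m in matchings n k)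
     q_var n ^+ crn m * t_var n ^+ nest m * x_mon (MDes m)
  = \sum_(m in matchings n k)
     q_var n ^+ nest m * t_var n ^+ crn m * x_mon (Des m).
Proof.
have swap12K : involutive swap12 by case=> [|[|[|t]]].
(* The order of the types is changed first, with [crn] and [nest] in place; conjugation then
   exchanges these two and turns the descents into [Des]. *)
transitivity (\sum_(m in matchings n k)
    q_var n ^+ crn m * t_var n ^+ nest m * x_mon (descents swap12 m)).
  rewrite -(@descents_equidistributed _ n k (fun c d => q_var n ^+ c * t_var n ^+ d)
    (@x_mon n) id) //; last exact: inv_inj.
  by apply: eq_bigr => m /matchingsP[mK _]; rewrite MDesE.
have conjM (m : 'S_n) : m \in matchings n k -> conj_matching m \in matchings n k.
  move=> /matchingsP[mK <-]; have [mK' C] := conj_matchingP mK.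
  apply/matchingsP; split=> //; apply: eq_card => p; rewrite !inE.
  have C' := conjugate_sym C.
  have := opener_conjugate mK C (p := p); have := opener_conjugate mK' C' (p := p).
  have := closer_conjugate mK mK' C (p := p); have := closer_conjugate mK' mK C' (p := p).
  by rewrite -!(inj_eq val_inj) /=; lia.
rewrite [RHS](reindex_onto (@conj_matching n) (@conj_matching n)) /=; last first.
  by move=> m /matchingsP[mK _]; apply: conj_matchingK.
apply: eq_big => [m|m /matchingsP[mK _]].
  apply/idP/andP => [hm|[hm /eqP <-]]; last exact: conjM.
  by rewrite conjM // conj_matchingK //; case/matchingsP: hm.
have [mK' C] := conj_matchingP mK.
by rewrite (Des_conjugate mK mK' C) (crn_conjugate C) (crn_conjugate (conjugate_sym C)).
Qed.
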